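(* Let $n\ge 2$ and $m\ge n$. The element $$J=\det\begin{pmatrix}t(x_1^2)&t(x_1x_2)&\cdots&t(x_1x_n)&t(x_1)\\ t(x_2x_1)&t(x_2^2)&\cdots&t(x_2x_n)&t(x_2)\\ \vdots&\vdots&\ddots&\vdots&\vdots\\ t(x_nx_1)&t(x_nx_2)&\cdots&t(x_n^2)&t(x_n)\\ t(x_1)&t(x_2)&\cdots&t(x_n)&n\end{pmatrix}\in\ker(\varphi_{n,m}^n)$$ does not belong to the ideal $(\mathcal F_{n,m}^n)^{(+)}\cdot\ker(\varphi_{n,m}^n)$. In particular, denoting by $2^n=(2,\dots,2)$ the partition with $n$ non-zero parts, all equal to $2$, we have $\mathrm{mult}_n(2^n)=1$.
   Context: Notation. $S_n$ acts on $V=\mathbb C^n$ by permuting coordinates and diagonally on $V^m$; $\mathbb C[V^m]=\mathbb C[x_{ij}\mid 1\le i\le n,\,1\le j\le m]$, where $x_{ij}$ is the $i$th coordinate function on the $j$th vector component, and $R_{n,m}=\mathbb C[V^m]^{S_n}$. For a monomial $w=x_1^{\alpha_1}\cdots x_m^{\alpha_m}$ put $[w]=\sum_{i=1}^n x_{i1}^{\alpha_1}\cdots x_{im}^{\alpha_m}\in R_{n,m}$. $\mathcal F_{n,m}^d$ is the polynomial algebra over $\mathbb C$ in independent variables $t(w)$, one for each monomial $w$ in $x_1,\dots,x_m$ with $1\le\deg w\le d$. The algebra homomorphism $\varphi_{n,m}^d:\mathcal F_{n,m}^d\to R_{n,m}$ sends $t(w)\mapsto[w]$; it is surjective for $d\ge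 n$. $\mathrm{GL}_m=\mathrm{GL}_m(\mathbb C)$ acts on $\mathbb C[x_1,\dots,x_m]$ by algebra automorphisms, $g$ sending $x_i$ to the $i$th entry of the row vector $(x_1,\dots,x_m)g$, and on $\mathcal F_{n,m}^d$ by algebra automorphisms with $g\cdot t(w)=t(g\cdot w)$, where $t$ is extended linearly to polynomials. $\ker(\varphi_{n,m}^n)$ is a $\mathrm{GL}_m$-submodule. $\mathcal F_{n,m}^n$ is graded by $\deg t(w)=\deg w$; $(\mathcal F_{n,m}^n)^{(+)}$ is the ideal spanned by homogeneous elements of positive degree. For a partition $\lambda$, $h(\lambda)$ is its number of non-zero parts; for $h(\lambda)\le m$, $V_\lambda$ is the irreducible polynomial $\mathrm{GL}_m$-module of highest weight $\lambda$, and $\mathrm{mult}_{n,m}(\lambda)$ is the multiplicity of $V_\lambda$ in the $\mathrm{GL}_m$-module $\ker(\varphi_{n,m}^n)/\big((\mathcal F_{n,m}^n)^{(+)}\ker(\varphi_{n,m}^n)\big)$. Put $\mathrm{mult}_n(\lambda):=\mathrm{mult}_{n,h(\lambda)}(\lambda)$. *)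

(* Defs.v *)
From HB Require Import structures.
From mathcomp Require Import all_boot all_order all_algebra ring_quotient.
From mathcomp Require Import boolp reals complex mpoly.

Set Implicit Arguments.
Unset Strict Implicit.
Unset Printing Implicit Defensive.

Import GRing.Theory.
Local Open Scope ring_scope.
Local Open Scope quotient_scope.

Section QuotientModule.
Variables (C : nzRingType) (V : lmodType C) (I : zmodClosed V).

Definition scale_closed := forall a (u : V), u \in I -> a *: u \in I.

(* The quotient V / I as a module; the closure proof is an argument because the
   scaling is attached to this type. *)
Definition modquot of scale_closed := Quotient.quot I.

Variable IZ : scale_closed.
Local Notation Q := (modquot IZ).
HB.instance Definition _ := GRing.Zmodule.on Q.

Definition modquot_pi (u : V) : Q := \pi_(Quotient.quot I) u.
Definition modquot_repr (x : Q) : V := repr (x : Quotient.quot I).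
Definition modquot_scale (a : C) (x : Q) : Q := modquot_pi (a *: modquot_repr x).

Lemma modquot_reprK x : modquot_pi (modquot_repr x) = x.
Proof. exact: reprK. Qed.

Lemma modquotP (u v : V) : modquot_pi u = modquot_pi v <-> u - v \in I.
Proof.
by rewrite Quotient.idealrBE; split=> [e|/eqP //]; apply/eqP; exact: e.
Qed.

Lemma modquot_piD (u v : V) : modquot_pi (u + v) = modquot_pi u + modquot_pi v.
Proof. exact: (raddfD (\pi_(Quotient.quot I))). Qed.

Lemma modquot_scaleE a (u : V) :
  modquot_scale a (modquot_pi u) = modquot_pi (a *: u).
Proof.
by apply/modquotP; rewrite -scalerBr IZ //; apply/modquotP; rewrite modquot_reprK.
Qed.

Lemma modquot_scaleA a b x :
  modquot_scale a (modquot_scale b x) = modquot_scale (a * b) x.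
Proof. by rewrite -[x]modquot_reprK !modquot_scaleE scalerA. Qed.

Lemma modquot_scale1 : left_id 1 modquot_scale.
Proof. by move=> x; rewrite -[x]modquot_reprK !modquot_scaleE scale1r. Qed.

Lemma modquot_scaleDr : right_distributive modquot_scale +%R.
Proof.
move=> a x y; rewrite -[x]modquot_reprK -[y]modquot_reprK.
by rewrite -modquot_piD !modquot_scaleE -modquot_piD scalerDr.
Qed.

Lemma modquot_scaleDl x : {morph modquot_scale^~ x : a b / a + b}.
Proof.
move=> a b /=; rewrite -[x]modquot_reprK.
by rewrite !modquot_scaleE -modquot_piD scalerDl.
Qed.

HB.instance Definition _ := GRing.Zmodule_isLmodule.Build C Q
  modquot_scaleA modquot_scale1 modquot_scaleDr modquot_scaleDl.

Lemma modquot_piZ a (u : V) : modquot_pi (a *: u) = a *: modquot_pi u.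
Proof. by rewrite -modquot_scaleE. Qed.

End QuotientModule.

(* GL_m is represented by the invertible matrices in 'M_m; the action of a
   singular matrix is never used. *)
Section GLModules.
Variables (C : fieldType) (m : nat) (V : lmodType C).
Variable act : 'M[C]_m -> V -> V.

Definition subspace (W : V -> Prop) :=
  W 0 /\ forall (a : C) (u v : V), W u -> W v -> W (a *: u + v).

Definition submodule (W : V -> Prop) :=
  subspace W /\ forall g v, g \in unitmx -> W v -> W (act g v).

Definition irreducible (W : V -> Prop) :=
  [/\ submodule W,
      exists2 v, W v & v <> 0
    & forall W' : V -> Prop, submodule W' -> (forall v, W' v -> W v) ->
      (exists2 v, W' v & v <> 0) -> forall v, W v -> W' v].

Definition is_basis (k : nat) (e : 'I_k -> V) (W : V -> Prop) :=
  (forall a, W (e a)) /\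
  (forall v, W v -> exists! c : 'rV[C]_k, v = \sum_a c 0 a *: e a).

(* W is finite dimensional, and the matrix coefficients of the action on W
   are polynomials in the m ^ 2 entries of the group element. *)
Definition polynomial_rep (W : V -> Prop) :=
  exists (k : nat) (e : 'I_k -> V) (P : 'I_k -> 'I_k -> {mpoly C[m * m]}),
    is_basis e W /\
    forall g a, g \in unitmx ->
      act g (e a) = \sum_b (P a b).@[mxvec g 0] *: e b.

Definition has_weight (lam : seq nat) (v : V) :=
  forall d : 'rV[C]_m, diag_mx d \in unitmx ->
    act (diag_mx d) v = (\prod_i d 0 i ^+ nth 0%N lam i) *: v.

Definition upper_unitriangular (g : 'M[C]_m) :=
  (forall i j : 'I_m, (j < i)%N -> g i j = 0) /\ (forall i, g i i = 1).

Definition highest_weight_vector (lam : seq nat) (v : V) :=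
  [/\ v <> 0, has_weight lam v
    & forall g, upper_unitriangular g -> act g v = v].

(* The GL_m-submodule W of V is isomorphic to V_lam. *)
Definition is_irrep (lam : seq nat) (W : V -> Prop) :=
  [/\ irreducible W, polynomial_rep W
    & exists2 v, W v & highest_weight_vector lam v].

(* The multiplicity of V_lam in the submodule N is k: the V_lam-isotypic
   component of N, i.e. the sum of its submodules isomorphic to V_lam, is the
   direct sum of k of them. *)
Definition multiplicity (N : V -> Prop) (lam : seq nat) (k : nat) :=
  exists W : 'I_k -> V -> Prop,
    [/\ forall a, is_irrep lam (W a) /\ (forall v, W a v -> N v),
        forall w : 'I_k -> V, (forall a, W a (w a)) ->
          \sum_a w a = 0 -> forall a, w a = 0
      & forall W' : V -> Prop, is_irrep lam W' -> (forall v, W' v -> N v) ->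
          forall v, W' v ->
          exists2 w : 'I_k -> V, (forall a, W a (w a)) & v = \sum_a w a].

End GLModules.

Section Generators.
Variables (C : fieldType) (m d : nat).

(* The monomials w in x_1, ..., x_m with 1 <= deg w <= d. *)
Definition gen := {w : 'X_{1..m < d.+1} | (0 < mdeg w)%N}.
Definition ngen := #|{: gen}|.
Definition gen_mon (k : 'I_ngen) : 'X_{1..m} := val (val (enum_val k)).

(* The variable 'X_k stands for t(gen_mon k). *)
Definition Falg := {mpoly C[ngen]}.
HB.instance Definition _ := GRing.ComNzRing.on Falg.
HB.instance Definition _ := GRing.Lmodule.on Falg.

(* Linear extension of w |-> t(w); the monomials of degree 0 or > d, for which
   there is no t(w), are sent to 0. *)
Definition tlin (p : {mpoly C[m]}) : Falg :=
  \sum_(k < ngen) p@_(gen_mon k) *: 'X_k.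

Definition act_poly (g : 'M[C]_m) (p : {mpoly C[m]}) : {mpoly C[m]} :=
  p \mPo [tuple \sum_(l < m) g l i *: 'X_l | i < m].

Definition actF (g : 'M[C]_m) (f : Falg) : Falg :=
  f \mPo [tuple tlin (act_poly g 'X_[gen_mon k]) | k < ngen].

(* The degree of a monomial of Falg for the grading deg t(w) = deg w. *)
Definition gdeg (mu : 'X_{1..ngen}) : nat := (\sum_k mu k * mdeg (gen_mon k))%N.

Lemma gdeg0 : gdeg 0 = 0%N.
Proof. by rewrite /gdeg big1 // => k _; rewrite mnm0E mul0n. Qed.

Lemma gdegD : {morph gdeg : m1 m2 / (m1 + m2)%MM >-> (m1 + m2)%N}.
Proof.
move=> m1 m2; rewrite /gdeg -big_split /=.
by apply: eq_bigr => k _; rewrite mnmDE mulnDl.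
Qed.

Lemma gdeg1 k : gdeg U_(k) = mdeg (gen_mon k).
Proof.
rewrite /gdeg (bigD1 k) //= big1 => [|l nlk].
  by rewrite mnm1E eqxx mul1n addn0.
by rewrite mnm1E eq_sym (negbTE nlk).
Qed.

HB.instance Definition _ := isMeasure.Build ngen gdeg gdeg0 gdegD.

Definition Fplus (f : Falg) : Prop :=
  exists2 s : seq Falg,
    (forall h, h \in s -> exists2 e, (0 < e)%N & h \is ishomog1 e gdeg)
    & f = \sum_(h <- s) h.

Lemma gen_mon_bound k : (0 < mdeg (gen_mon k) <= d)%N.
Proof. by rewrite (valP (enum_val k)) -ltnS (valP (val (enum_val k))). Qed.

Lemma gen_monP (w : 'X_{1..m}) :
  (0 < mdeg w <= d)%N -> exists k, gen_mon k = w.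
Proof.
case/andP=> w0 wd; rewrite -ltnS in wd.
by exists (enum_rank (exist _ (BMultinom wd) w0 : gen)); rewrite /gen_mon enum_rankK.
Qed.

Lemma gen_mon_inj : injective gen_mon.
Proof. by move=> k l /val_inj /val_inj /enum_val_inj. Qed.

Lemma act_poly_homog g (w : 'X_{1..m}) :
  act_poly g 'X_[w] \is ishomog1 (mdeg w) mdeg.
Proof.
rewrite /act_poly comp_mpolyX mdegE.
have := @dhomog_prod m C mdeg m [tuple w i | i < m]
  [tuple (\sum_(l < m) g l i *: 'X_l) ^+ w i | i < m].
rewrite !big_tuple (eq_bigr (fun i => w i)); last by move=> i _; rewrite tnth_mktuple.
rewrite (eq_bigr (fun i => (tnth [tuple \sum_(l < m) g l i0 *: 'X_l | i0 < m] i) ^+ w i));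
  last by move=> i _; rewrite !tnth_mktuple.
apply=> i; rewrite !tnth_mktuple.
rewrite -[X in ishomog1 X _]mul1n; apply: dhomogMn.
by apply: rpred_sum => l _; apply: rpredZ; rewrite dhomogX; apply/eqP/mdeg1.
Qed.

Lemma tlin_homog e p : p \is ishomog1 e mdeg -> tlin p \is ishomog1 e gdeg.
Proof.
move=> hp; apply: rpred_sum => k _.
have [->|nz] := eqVneq (p@_(gen_mon k)) 0; first by rewrite scale0r rpred0.
apply: rpredZ; rewrite dhomogX; apply/eqP/(etrans (gdeg1 k)).
by apply: (dhomog_mf hp); rewrite mcoeff_msupp.
Qed.

Lemma actF_homog g e f : f \is ishomog1 e gdeg -> actF g f \is ishomog1 e gdeg.
Proof.
move=> hf; rewrite /actF comp_mpolyE big_seq; apply: rpred_sum => mu hmu.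
apply: rpredZ; rewrite -(dhomog_mf hf hmu) /gdeg.
have := @dhomog_prod ngen C gdeg ngen
  [tuple (mu k * mdeg (gen_mon k))%N | k < ngen]
  [tuple tlin (act_poly g 'X_[gen_mon k]) ^+ mu k | k < ngen].
rewrite !big_tuple (eq_bigr (fun k => (mu k * mdeg (gen_mon k))%N));
  last by move=> i _; rewrite tnth_mktuple.
rewrite (eq_bigr (fun i =>
  (tnth [tuple tlin (act_poly g 'X_[gen_mon k]) | k < ngen] i) ^+ mu i));
  last by move=> i _; rewrite !tnth_mktuple.
apply=> i; rewrite !tnth_mktuple mulnC; apply: dhomogMn.
exact/tlin_homog/act_poly_homog.
Qed.

Lemma actF_Fplus g f : Fplus f -> Fplus (actF g f).
Proof.
case=> s hs ->; exists [seq actF g h | h <- s].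
  by move=> _ /mapP[h /hs[e e0 he] ->]; exists e => //; apply: actF_homog.
by rewrite big_map /actF raddf_sum.
Qed.

Lemma Fplus_scale a f : Fplus f -> Fplus (a *: f).
Proof.
case=> s hs ->; exists [seq a *: h | h <- s].
  by move=> _ /mapP[h /hs[e e0 he] ->]; exists e => //; apply: rpredZ.
by rewrite big_map scaler_sumr.
Qed.

End Generators.

Section Kernel.
Variables (C : fieldType) (n m d : nat).
Local Notation Falg := (Falg C m d).

Definition xij (i : 'I_n) (j : 'I_m) : {mpoly C[n * m]} := 'X_(mxvec_index i j).

Definition power_sum (w : 'X_{1..m}) : {mpoly C[n * m]} :=
  \sum_(i < n) \prod_(j < m) xij i j ^+ w j.

(* The values of phi are S_n-invariant; only its kernel matters here, so phi is
   taken with values in the whole ring C[V^m]. *)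
Definition phi (f : Falg) : {mpoly C[n * m]} :=
  f \mPo [tuple power_sum (gen_mon k) | k < ngen m d].

Definition ker_phi (f : Falg) : Prop := phi f = 0.

(* The ideal F^(+) ker(phi). *)
Definition Fplus_ker (f : Falg) : Prop :=
  exists2 s : seq (Falg * Falg),
    (forall ab, ab \in s -> Fplus ab.1 /\ ker_phi ab.2)
    & f = \sum_(ab <- s) ab.1 * ab.2.

Lemma comp_mpolyA (a b c : nat) (p : {mpoly C[a]}) (q : a.-tuple {mpoly C[b]})
    (r : b.-tuple {mpoly C[c]}) :
  (p \mPo q) \mPo r = p \mPo [tuple tnth q i \mPo r | i < a].
Proof.
rewrite [p \mPo q]comp_mpolyE [RHS]comp_mpolyE raddf_sum /=.
apply: eq_bigr => w _; rewrite linearZ /= rmorph_prod; congr (_ *: _).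
by apply: eq_bigr => i _; rewrite rmorphXn /= tnth_mktuple.
Qed.

Lemma power_sum_comp w :
  power_sum w = \sum_(i < n) ('X_[w] \mPo [tuple xij i j | j < m]).
Proof.
apply: eq_bigr => i _; rewrite comp_mpolyX.
by apply: eq_bigr => j _; rewrite tnth_mktuple.
Qed.

(* The action of g on C[V^m] that makes phi equivariant. *)
Definition actV (g : 'M[C]_m) (p : {mpoly C[n * m]}) : {mpoly C[n * m]} :=
  p \mPo [tuple mxvec (\matrix_(i < n, j < m) \sum_(l < m) g l j *: xij i l) 0 k
         | k < n * m].

Lemma phi_tlin (p : {mpoly C[m]}) e : (0 < e <= d)%N -> p \is ishomog1 e mdeg ->
  phi (tlin d p) = \sum_(i < n) (p \mPo [tuple xij i j | j < m]).
Proof.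
move=> he hp; rewrite /phi /tlin raddf_sum /=.
transitivity (\sum_(k < ngen m d) p@_(gen_mon k) *: power_sum (gen_mon k)).
  apply: eq_bigr => k _; rewrite linearZ /=; congr (_ *: _).
  by rewrite comp_mpolyXU -tnth_nth tnth_mktuple.
transitivity (\sum_(w <- msupp p) p@_w *: power_sum w); last first.
  under [RHS]eq_bigr => i _ do rewrite comp_mpolyEX.
  rewrite exchange_big /=; apply: eq_bigr => w _.
  by rewrite power_sum_comp scaler_sumr.
rewrite (bigID (fun k => gen_mon k \in msupp p)) /= [X in _ + X]big1 ?addr0; last first.
  by move=> k /memN_msupp_eq0 ->; rewrite scale0r.
rewrite -big_filter -(big_map (@gen_mon m d) xpredT
  (fun w => p@_w *: power_sum w)) /=.
apply: perm_big; apply: uniq_perm => //.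
  by rewrite map_inj_uniq ?filter_uniq ?index_enum_uniq //; apply: gen_mon_inj.
move=> w; apply/mapP/idP => [[k]|hw]; first by rewrite mem_filter => /andP[h _] ->.
have [|k kw] := @gen_monP m d w; first by rewrite (dhomog_mf hp hw).
by exists k; rewrite // mem_filter kw hw mem_index_enum.
Qed.

Lemma phi_actF g f : phi (actF g f) = actV g (phi f).
Proof.
rewrite /phi /actF /actV !comp_mpolyA; congr (_ \mPo _).
apply: eq_from_tnth => k; rewrite !tnth_mktuple.
rewrite -[LHS]/(phi _) (phi_tlin (gen_mon_bound k) (act_poly_homog _ _)).
rewrite power_sum_comp raddf_sum /=; apply: eq_bigr => i _.
rewrite /act_poly !comp_mpolyA; congr (_ \mPo _).
apply: eq_from_tnth => j; rewrite !tnth_mktuple raddf_sum /= comp_mpolyXU.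
rewrite -tnth_nth tnth_mktuple mxvecE mxE; apply: eq_bigr => l _.
by rewrite linearZ /= comp_mpolyXU -tnth_nth tnth_mktuple.
Qed.

Lemma actF_ker g f : ker_phi f -> ker_phi (actF g f).
Proof. by rewrite /ker_phi phi_actF => ->; rewrite /actV raddf0. Qed.

Lemma actF_Fplus_ker g f : Fplus_ker f -> Fplus_ker (actF g f).
Proof.
case=> s hs ->; exists [seq (actF g ab.1, actF g ab.2) | ab <- s].
  move=> _ /mapP[ab /hs[h1 h2] ->] /=; split; first exact: actF_Fplus.
  exact: actF_ker.
by rewrite big_map /actF raddf_sum; apply: eq_bigr => ab _; rewrite /= rmorphM.
Qed.

Lemma Fplus_ker_scale a f : Fplus_ker f -> Fplus_ker (a *: f).
Proof.
case=> s hs ->; exists [seq (a *: ab.1, ab.2) | ab <- s].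
  by move=> _ /mapP[ab /hs[h1 h2] ->] /=; split=> //; apply: Fplus_scale.
by rewrite big_map scaler_sumr; apply: eq_bigr => ab _; rewrite /= scalerAl.
Qed.

Lemma Fplus_kerD f h : Fplus_ker f -> Fplus_ker h -> Fplus_ker (f + h).
Proof.
case=> s hs -> [s' hs' ->]; exists (s ++ s'); last by rewrite big_cat.
by move=> ab; rewrite mem_cat => /orP[/hs|/hs'].
Qed.

Lemma Fplus_ker0 : Fplus_ker 0.
Proof. by exists [::]; rewrite ?big_nil. Qed.

Definition Fplus_ker_pred (f : Falg) : bool := `[< Fplus_ker f >].

Lemma Fplus_ker_zmod : zmod_closed Fplus_ker_pred.
Proof.
split=> [|f h /asboolP hf /asboolP hh]; apply/asboolP; first exact: Fplus_ker0.
by apply: Fplus_kerD => //; rewrite -scaleN1r; apply: Fplus_ker_scale.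
Qed.

HB.instance Definition _ := GRing.isZmodClosed.Build Falg Fplus_ker_pred
  Fplus_ker_zmod.

Lemma Fplus_ker_scale_closed : scale_closed (GRing.ZmodClosed.clone _ Fplus_ker_pred _).
Proof. by move=> a f /asboolP hf; apply/asboolP; apply: Fplus_ker_scale. Qed.

(* F / (F^(+) ker(phi)) *)
Definition FmodK := modquot Fplus_ker_scale_closed.
HB.instance Definition _ := GRing.Lmodule.on FmodK.

Definition piK (f : Falg) : FmodK := modquot_pi Fplus_ker_scale_closed f.

Definition reprFmodK (x : FmodK) : Falg :=
  @modquot_repr _ _ _ Fplus_ker_scale_closed x.

(* This does not depend on the choice of representative, by actK_pi. *)
Definition actK (g : 'M[C]_m) (x : FmodK) : FmodK := piK (actF g (reprFmodK x)).

Lemma piKP f h : piK f = piK h <-> Fplus_ker (f - h).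
Proof.
split=> [/(modquotP Fplus_ker_scale_closed)/asboolP //|fh].
by apply/(modquotP Fplus_ker_scale_closed)/asboolP.
Qed.

Lemma piK_is_linear a f h : piK (a *: f + h) = a *: piK f + piK h.
Proof.
rewrite -[RHS](congr1 (+%R^~ (piK h)) (modquot_piZ Fplus_ker_scale_closed a f)).
exact: (modquot_piD Fplus_ker_scale_closed).
Qed.

Lemma actK_pi g f : actK g (piK f) = piK (actF g f).
Proof.
apply/piKP; rewrite -[_ - _](raddfB (comp_mpoly _)); apply: actF_Fplus_ker.
by apply/piKP; rewrite /piK modquot_reprK.
Qed.

(* ker(phi) / (F^(+) ker(phi)), as a submodule of FmodK *)
Definition kerK (x : FmodK) : Prop := exists2 f, ker_phi f & x = piK f.

End Kernel.

Definition mult_nm (C : fieldType) (n m : nat) (lam : seq nat) (k : nat) : Prop :=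
  multiplicity (@actK C n m n) (@kerK C n m n) lam k.

Definition height (lam : seq nat) : nat := count (fun p => 0 < p)%N lam.

(* mult_n(lam) = k *)
Definition mult (C : fieldType) (n : nat) (lam : seq nat) (k : nat) : Prop :=
  mult_nm C n (height lam) lam k.

Definition J (C : fieldType) (n m : nat) (hnm : (n <= m)%N) : Falg C m n :=
  let X (i : 'I_n) : {mpoly C[m]} := 'X_(widen_ord hnm i) in
  \det (block_mx (\matrix_(i < n, j < n) tlin n (X i * X j))
                 (\col_(i < n) tlin n (X i))
                 (\row_(j < n) tlin n (X j))
                 (n%:R)%:M : 'M[Falg C m n]_(n + 1)).

(* Main.v *)
From HB Require Import structures.
Require Import Defs.
From mathcomp Require Import all_boot all_order fingroup perm all_algebra reals complex.
From mathcomp Require Import mpoly ring.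

(* For polynomials f, g let <g, f> be the constant term of f(d/dx) g, so that
   multiplication by x_k is adjoint to d/dx_k.

   J is not in F+ ker(phi).  Let D = det(y_aj) be the generic n x n determinant
   in the coordinates of n points, and let q : F -> F kill every t(w) with
   deg w <> 2.  The functional f |-> <D^2, phi(q f)> takes the value n <D^2, D^2>
   on J, which is not 0.  It vanishes on t(w) b for b in ker(phi).  If deg w <> 2
   this is clear, and for w = x_j x_j' the value is 2 sum_a <d_aj D d_aj' D, phi(q b)>.
   Every monomial of phi(q b) has even degree in each point, so the terms
   <d_aj D d_bj' D, phi(q b)> with a <> b vanish and the sum equals
   <D_j D_j', phi(q b)> with D_j = sum_a d_aj D.  Now D_j D_j' is translation
   invariant and has degree at most 2 in each point, so it is killed by
   [w](d/dy) unless deg w = 2; hence the value is <D_j D_j', phi(b)> = 0.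

   The multiplicity is 1.  For m = n, actF g J = det(g)^2 J, so J spans a copy of
   V_(2^n).  Conversely a highest weight vector of weight 2^n in
   ker(phi) / F+ ker(phi) is multiplied by det(g)^2 under every g in GL_n: by
   SL_2 its image under 1 + s E_ji is a polynomial both in s and in 1/s.  Lift it
   to b in ker(phi) and apply to g b, for the generic matrix g = z + z', the
   operator det(d/dz) det(d/dz').  This gives an element of ker(phi), congruent
   to a nonzero multiple of b modulo F+ ker(phi).  On the other hand det is
   alternating and t(w) is symmetric in the letters of w, so only products of
   t(x_i x_j) and at most two t(x_i) survive, and the result is a combination of
   det(T) and s^T adj(T) s, where T = (t(x_i x_j)) and s = (t(x_i)); the only such
   combinations in ker(phi) are the multiples of J = n det(T) - s^T adj(T) s. *)

Set Implicit Arguments.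
Unset Strict Implicit.
Unset Printing Implicit Defensive.

Import Order.TTheory GRing.Theory Num.Theory.
Local Open Scope ring_scope.

(** * The apolarity pairing *)

Section Pairing.
Variables (A : comNzRingType) (N : nat).
Implicit Types (f g : {mpoly A[N]}) (m : 'X_{1..N}).

Definition mnmfact m : nat := \prod_i (m i)`!.

(** Monomials are orthogonal, and [mnmfact m] is the value of the monomial of exponent [m] against
    itself, so this is the constant term of f(d/dx) g. *)
Definition pairing g f : A :=
  \sum_(m <- msupp g) f@_m * (g@_m *+ mnmfact m).

Lemma pairing_is_linear g : scalar (pairing g).
Proof.
move=> a f h; rewrite /pairing mulr_sumr -big_split /=.
by apply: eq_bigr => m _; rewrite mcoeffD mcoeffZ mulrDl mulrA.
Qed.

HB.instance Definition _ g :=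
  GRing.isLinear.Build A {mpoly A[N]} A *%R (pairing g) (pairing_is_linear g).

Lemma pairingC f g : pairing g f = pairing f g.
Proof.
rewrite /pairing (bigID (fun m => m \in msupp f)) /= [X in _ + X]big1 ?addr0; last first.
  by move=> m /memN_msupp_eq0 ->; rewrite mul0r.
rewrite [RHS](bigID (fun m => m \in msupp g)) /= [X in _ + X]big1 ?addr0; last first.
  by move=> m /memN_msupp_eq0 ->; rewrite mul0r.
rewrite -big_filter -[RHS]big_filter.
transitivity (\sum_(m <- [seq m <- msupp f | m \in msupp g]) f@_m * (g@_m *+ mnmfact m)).
  apply: perm_big; apply: uniq_perm; rewrite ?filter_uniq ?msupp_uniq //.
  by move=> m; rewrite !mem_filter andbC.
by apply: eq_bigr => m _; rewrite !mulrnAr mulrC.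
Qed.

Lemma pairingDl f g h : pairing (g + h) f = pairing g f + pairing h f.
Proof. by rewrite !(pairingC f) linearD. Qed.

Lemma pairingNl f g : pairing (- g) f = - pairing g f.
Proof. by rewrite !(pairingC f) linearN. Qed.

Lemma pairing0l f : pairing 0 f = 0.
Proof. by rewrite !(pairingC f) linear0. Qed.

Lemma pairing_suml f (I : Type) (r : seq I) P (F : I -> {mpoly A[N]}) :
  pairing (\sum_(i <- r | P i) F i) f = \sum_(i <- r | P i) pairing (F i) f.
Proof. by rewrite pairingC linear_sum; apply: eq_bigr => i _; rewrite pairingC. Qed.

Lemma pairingX m g : pairing g 'X_[m] = g@_m *+ mnmfact m.
Proof.
rewrite /pairing.
have [gm|/memN_msupp_eq0 gm] := boolP (m \in msupp g); last first.
  rewrite gm mul0rn big_seq big1 // => m' hm'.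
  rewrite mcoeffX; case: eqP => [e|_]; last by rewrite mul0r.
  by rewrite -e gm mul0rn mulr0.
rewrite (bigD1_seq m) ?msupp_uniq //= mcoeffX eqxx mul1r big1 ?addr0 // => m' nm.
by rewrite mcoeffX eq_sym (negbTE nm) mul0r.
Qed.

Lemma mnmfactDU m k : mnmfact (m + U_(k)) = (mnmfact m * (m k).+1)%N.
Proof.
rewrite /mnmfact (bigD1 k) //= [in RHS](bigD1 k) //= mnmDE mnm1E eqxx addn1 factS.
rewrite -mulnA mulnC; congr (_ * _)%N.
congr (_ * _)%N; apply: eq_bigr => i nik.
by rewrite mnmDE mnm1E eq_sym (negbTE nik) addn0.
Qed.

(** Raising the exponent of ['X_k] multiplies [mnmfact] by exactly the factor that the derivative
    brings down. *)
Lemma pairing_XM k f g : pairing g ('X_k * f) = pairing g^`M(k) f.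
Proof.
rewrite [f]mpolyE mulr_sumr !linear_sum /=.
apply: eq_bigr => m _; rewrite -scalerAr !linearZ /=.
congr (_ * _); rewrite -mpolyXD !pairingX mcoeff_deriv addmC mnmfactDU.
by rewrite -mulrnA mulnC.
Qed.

Lemma pairing1 g : pairing g 1 = g@_0.
Proof.
rewrite -mpolyX0 pairingX /mnmfact big1 // => i _.
by rewrite mnm0E.
Qed.

Lemma pairing_homog (mf : measure N) d e f g :
  f \is ishomog1 d mf -> g \is ishomog1 e mf -> d != e -> pairing g f = 0.
Proof.
move=> hf hg nde; rewrite /pairing big_seq big1 // => m hm.
have [mf'|/memN_msupp_eq0 ->] := boolP (m \in msupp f); last by rewrite mul0r.
by rewrite -(dhomog_mf hf mf') -(dhomog_mf hg hm) eqxx in nde.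
Qed.

End Pairing.

Lemma pairing_map (A B : comNzRingType) (s : {rmorphism A -> B}) N (f g : {mpoly A[N]}) :
  pairing (map_mpoly s g) (map_mpoly s f) = s (pairing g f).
Proof.
have -> : map_mpoly s f = \sum_(m <- msupp f) s f@_m *: 'X_[m].
  apply/mpolyP => m; rewrite mcoeff_map_mpoly [in LHS](mpolyE f).
  rewrite (raddf_sum (mcoeff m)) (raddf_sum s) (raddf_sum (mcoeff m)) /=.
  by apply: eq_bigr => m' _; rewrite !mcoeffZ !mcoeffX rmorphM /= rmorph_nat.
rewrite [in RHS](mpolyE f).
rewrite !linear_sum /= rmorph_sum /=; apply: eq_bigr => m _.
by rewrite !linearZ /= rmorphM !pairingX rmorphMn /= mcoeff_map_mpoly.
Qed.

(** Over the integers the pairing is a sum of squares with positive weights. Over the complex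
    numbers the bilinear pairing is not definite, so nonvanishing is proved here and transported by
    [pairing_map]. *)
Lemma pairing_gt0 N (f : {mpoly int[N]}) : f != 0 -> (0 < pairing f f)%R.
Proof.
move=> nf; rewrite /pairing lt0r.
have ge0 m : m \in msupp f -> 0 <= f@_m * (f@_m *+ mnmfact m).
  by move=> _; rewrite mulrnAr mulrn_wge0 // -expr2 sqr_ge0.
rewrite big_seq sumr_ge0 // andbT psumr_neq0 //.
apply/hasP; exists (mlead f); first exact: mlead_supp.
rewrite mlead_supp //= mulrnAr pmulrn_lgt0; last first.
  by rewrite /mnmfact prodn_gt0 // => i; rewrite fact_gt0.
by rewrite -expr2 exprn_even_gt0 //= mleadc_eq0.
Qed.

(** * Derivatives of the generic determinant *)

(** Monomials are built one variable at a time, to match the adjunction [pairing_XM]. *)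
Lemma mpoly_indX (A : nzRingType) N (P : {mpoly A[N]} -> Prop) :
  (forall c f g, P f -> P g -> P (c *: f + g)) -> P 1 ->
  (forall i f, P f -> P ('X_i * f)) -> forall f, P f.
Proof.
move=> PD P1 PX f; rewrite [f]mpolyE.
have P0 : P 0 by have := PD (-1) 1 1 P1 P1; rewrite scaleN1r addNr.
elim/big_rec: _ => // m g _ Pg; apply: PD => //.
have [k] := ubnP (mdeg m); elim: k m => // k IH m.
have [->|nm] := eqVneq m 0%MM; first by rewrite mpolyX0.
have [i mi] : exists i, m i != 0%N.
  apply/existsP; rewrite -negb_forall; apply: contra nm => /forallP h.
  by apply/eqP/mnmP => i; rewrite mnm0E; apply/eqP/h.
have -> : m = (U_(i) + (m - U_(i)))%MM.
  by rewrite addmC submK // lep1mP.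
rewrite mdegD mdeg1 mpolyXD add1n ltnS => h; apply: PX; exact: IH.
Qed.

Lemma mcoeff0_meval (A : comNzRingType) N (f : {mpoly A[N]}) : f@_0 = f.@[fun=> 0].
Proof.
elim/mpoly_indX: f => [c f g Hf Hg||i f _].
- by rewrite mcoeffD mcoeffZ mevalD mevalZ Hf Hg.
- by rewrite meval1 -mpolyC1 mcoeffC eqxx mulr1.
by rewrite mevalM mevalXU mul0r rmorphM /= mcoeffX mnm1_eq0 mul0r.
Qed.

Section Chain.
Variable A : comNzRingType.

Lemma mderivXU N (i k : 'I_N) : ('X_i : {mpoly A[N]})^`M(k) = (i == k)%:R.
Proof.
rewrite mderivX mnm1E; have [<-|_] := eqVneq i k; last by rewrite scale0r.
have -> : (U_(i) - U_(i) = 0)%MM by apply/mnmP => j; rewrite mnmBE mnm0E subnn.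
by rewrite mpolyX0 scale1r.
Qed.

Lemma mderiv_comp N M (f : {mpoly A[N]}) (t : N.-tuple {mpoly A[M]}) j :
  (f \mPo t)^`M(j) = \sum_i (f^`M(i) \mPo t) * (tnth t i)^`M(j).
Proof.
elim/mpoly_indX: f => [c f g Hf Hg||i f Hf].
- rewrite comp_mpolyD comp_mpolyZ mderivD mderivZ Hf Hg scaler_sumr -big_split /=.
  apply: eq_bigr => i _.
  by rewrite mderivD mderivZ comp_mpolyD comp_mpolyZ mulrDl scalerAl.
- rewrite comp_mpoly1 -mpolyC1 mderivC big1 // => i _.
  by rewrite -mpolyC1 mderivC comp_mpoly0 mul0r.
rewrite rmorphM /= mderivM Hf comp_mpolyXU -tnth_nth.
under [RHS]eq_bigr => k _ do
  rewrite mderivM comp_mpolyD !rmorphM /= mulrDl mderivXU rmorph_nat.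
rewrite big_split /=; congr (_ + _).
  rewrite (bigD1 i) //= big1 ?addr0 => [|k nki]; first by rewrite eqxx mul1r mulrC.
  by rewrite eq_sym (negbTE nki) !mul0r.
rewrite mulr_sumr; apply: eq_bigr => k _.
by rewrite comp_mpolyXU -tnth_nth mulrA.
Qed.

Definition rename N M (w : 'I_N -> 'I_M) (f : {mpoly A[N]}) : {mpoly A[M]} :=
  f \mPo [tuple 'X_(w k) | k < N].
HB.instance Definition _ N M (w : 'I_N -> 'I_M) :=
  GRing.LRMorphism.copy (rename w) (comp_mpoly [tuple 'X_(w k) | k < N]).

Lemma renameXU N M (w : 'I_N -> 'I_M) k : rename w 'X_k = 'X_(w k).
Proof. by rewrite /rename comp_mpolyXU -tnth_nth tnth_mktuple. Qed.

Lemma mderiv_rename N M (w : 'I_N -> 'I_M) f k :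
  injective w -> (rename w f)^`M(w k) = rename w f^`M(k).
Proof.
move=> wI; rewrite /rename mderiv_comp (bigD1 k) //= tnth_mktuple mderivXU eqxx mulr1.
rewrite big1 ?addr0 // => i nik; rewrite tnth_mktuple mderivXU.
by rewrite (inj_eq wI) (negbTE nik) mulr0.
Qed.

Lemma mderiv_rename0 N M (w : 'I_N -> 'I_M) f j :
  (forall k, w k != j) -> (rename w f)^`M(j) = 0.
Proof.
move=> wj; rewrite /rename mderiv_comp big1 // => i _.
by rewrite tnth_mktuple mderivXU (negbTE (wj i)) mulr0.
Qed.

Lemma mcoeff0_rename N M (w : 'I_N -> 'I_M) f : (rename w f)@_0 = f@_0.
Proof.
by rewrite !mcoeff0_meval comp_mpoly_meval; apply: meval_eq => i; rewrite tnth_mktuple mevalXU.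
Qed.

Lemma pairing_rename N M (w : 'I_N -> 'I_M) f g :
  injective w -> pairing (rename w g) (rename w f) = pairing g f.
Proof.
move=> wI; elim/mpoly_indX: f g => [c f1 f2 H1 H2|g|i f IH g].
- by move=> g; rewrite !linearD !linearZ /= H1 H2.
- by rewrite rmorph1 !pairing1 mcoeff0_rename.
by rewrite rmorphM /= renameXU !pairing_XM mderiv_rename // IH.
Qed.

Definition add_vars N : N.-tuple {mpoly A[N + N]} :=
  [tuple 'X_(lshift N k) + 'X_(rshift N k) | k < N].

(* Pairing with a product is dual to the substitution z |-> z + z'. *)
Lemma pairing_coprod N (f g h : {mpoly A[N]}) :
  pairing (rename (lshift N) g * rename (@rshift N N) h) (f \mPo add_vars N)
  = pairing (g * h) f.
Proof.
elim/mpoly_indX: f g h => [c f1 f2 H1 H2||i f IH] g h.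
- by rewrite comp_mpolyD comp_mpolyZ !linearD !linearZ /= H1 H2.
- by rewrite comp_mpoly1 !pairing1 !rmorphM /= !mcoeff0_rename.
rewrite rmorphM /= comp_mpolyXU -tnth_nth tnth_mktuple mulrDl linearD /= !pairing_XM.
rewrite !mderivM !mderiv_rename; try by [apply: lshift_inj | apply: rshift_inj].
rewrite [(rename (@rshift N N) h)^`M(_)]mderiv_rename0; last first.
  by move=> k; rewrite eq_rlshift.
rewrite [(rename (lshift N) g)^`M(_)]mderiv_rename0; last first.
  by move=> k; rewrite eq_lrshift.
by rewrite mulr0 addr0 mul0r add0r !IH -pairingDl.
Qed.
End Chain.

Section GenericDet.
Variables (A : comNzRingType) (n : nat).
Notation z l i := (mxvec_index l i : 'I_(n * n)).

Definition gdet : {mpoly A[n * n]} := \det (\matrix_(l < n, i < n) 'X_(z l i)).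

Lemma mxvec_index_inj m p (l l' : 'I_m) (i i' : 'I_p) :
  mxvec_index l i = mxvec_index l' i' -> l = l' /\ i = i'.
Proof. by move=> /cast_ord_inj /enum_rank_inj [-> ->]. Qed.

Lemma mderiv_prod_perm (P : pred 'I_n) (s : 'S_n) l i :
  (\prod_(c | P c) 'X_(z c (s c)) : {mpoly A[n * n]})^`M(z l i)
  = if P l && (s l == i) then \prod_(c | P c && (c != l)) 'X_(z c (s c)) else 0.
Proof.
case: ifP => [/andP[Pl /eqP <-]|nPl]; last first.
  apply: (big_ind (fun f : {mpoly A[n * n]} => f^`M(z l i) = 0)).
  - by rewrite -mpolyC1 mderivC.
  - by move=> f g Hf Hg; rewrite mderivM Hf Hg mul0r mulr0 addr0.
  move=> c Pc; rewrite mderivXU; case: eqP => // /mxvec_index_inj[cl si].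
  by move: nPl; rewrite -cl -si Pc eqxx.
rewrite (bigD1 l) //= mderivM mderivXU eqxx mul1r.
rewrite [X in _ + _ * X](_ : _ = 0) ?mulr0 ?addr0 //.
apply: (big_ind (fun f : {mpoly A[n * n]} => f^`M(z l (s l)) = 0)).
- by rewrite -mpolyC1 mderivC.
- by move=> f g Hf Hg; rewrite mderivM Hf Hg mul0r mulr0 addr0.
move=> c /andP[_ ncl]; rewrite mderivXU; case: eqP => // /mxvec_index_inj[cl _].
by rewrite cl eqxx in ncl.
Qed.

Lemma mderiv2_gdet l i l' j :
  gdet^`M(z l' j)^`M(z l i) = \sum_(s : 'S_n | [&& l != l', s l == i & s l' == j])
     (-1) ^+ s * \prod_(c | (c != l') && (c != l)) 'X_(z c (s c)).
Proof.
rewrite /gdet /determinant.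
under eq_bigr => s _ do under eq_bigr => c _ do rewrite mxE.
rewrite (raddf_sum (mderiv (z l' j))) (raddf_sum (mderiv (z l i))) [RHS]big_mkcond /=.
apply: eq_bigr => s _.
have E (b : bool) f k : ((-1) ^+ b * f : {mpoly A[n * n]})^`M(k) = (-1) ^+ b * f^`M(k).
  by case: b; rewrite ?expr1 ?expr0 ?mulN1r ?mul1r ?mderivN.
rewrite !E mderiv_prod_perm /=.
case: (s l' =P j) => [sj|_]; last by rewrite mderiv0 mulr0 !andbF.
rewrite mderiv_prod_perm andbT; case: ifP => //; rewrite ?mulr0 ?mulr1 //.
Qed.

(** The second derivative is a signed sum over the permutations with two prescribed values.
    Composing them with the transposition of [l] and [l'] exchanges these values and flips the
    sign. *)
Lemma mderiv2_gdet_antisym l i l' j :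
  gdet^`M(z l' j)^`M(z l i) = - gdet^`M(z l j)^`M(z l' i).
Proof.
rewrite !mderiv2_gdet -sumrN (reindex_inj (mulgI (tperm l l'))) /=.
apply: eq_big => s; rewrite !permM tpermL tpermR.
  by rewrite [l' == l]eq_sym; case: (l == l').
case/and3P=> nll _ _; rewrite odd_permM odd_tperm nll signr_addb expr1 -mulrA mulN1r.
congr (- (_ * _)); apply: eq_big => [c|c]; first by rewrite andbC.
by case/andP=> cl' cl; rewrite permM tpermD // eq_sym.
Qed.

Lemma mderiv2_gdet_row l i j : gdet^`M(z l j)^`M(z l i) = 0.
Proof. by rewrite mderiv2_gdet big_pred0 // => s; rewrite eqxx. Qed.

Lemma meval_gdet (g : 'M[A]_n) : gdet.@[mxvec g 0] = \det g.
Proof.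
rewrite /gdet -det_map_mx.
by congr (\det _); apply/matrixP => l i; rewrite !mxE [LHS]mevalXU mxvecE.
Qed.

Lemma gdet_neq0 : gdet != 0.
Proof.
apply/eqP => D0; have /eqP := meval_gdet 1%:M.
by rewrite D0 meval0 det1 eq_sym oner_eq0.
Qed.

End GenericDet.

Lemma map_gdet (A B : comNzRingType) (s : {rmorphism A -> B}) n :
  map_mpoly s (gdet A n) = gdet B n.
Proof.
rewrite /gdet -det_map_mx.
by congr (\det _); apply/matrixP => l i; rewrite !mxE; apply: map_mpolyX.
Qed.

Definition gdet_norm n : int :=
  pairing (gdet int n * gdet int n) (gdet int n * gdet int n).

Lemma gdet_norm_gt0 n : 0 < gdet_norm n.
Proof. by apply: pairing_gt0; rewrite mulf_neq0 // gdet_neq0. Qed.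

Lemma pairing_gdet (A : comNzRingType) n :
  pairing (gdet A n * gdet A n) (gdet A n * gdet A n) = (gdet_norm n)%:~R.
Proof.
rewrite -[RHS](pairing_map (intmul 1 : {rmorphism int -> A})).
by rewrite !rmorphM /= !(map_gdet (intmul 1 : {rmorphism int -> A})).
Qed.

(** * J is not generated in lower degree *)

Lemma eq_opp_eq0 (C : numFieldType) (V : lmodType C) (x : V) : x = - x -> x = 0.
Proof.
by move/eqP; rewrite -addr_eq0 -mulr2n -scaler_nat scaler_eq0 pnatr_eq0 => /eqP.
Qed.

Lemma mnm_pop N (w : 'X_{1..N}) : (0 < mdeg w)%N ->
  exists j w', w = (U_(j) + w')%MM /\ mdeg w = (mdeg w').+1.
Proof.
rewrite lt0n mdeg_eq0 => nw.
have [i wi] : exists i, w i != 0%N.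
  apply/existsP; rewrite -negb_forall; apply: contra nw => /forallP h.
  by apply/eqP/mnmP => i; rewrite mnm0E; apply/eqP/h.
have e : w = (U_(i) + (w - U_(i)))%MM by rewrite addmC submK // lep1mP.
by exists i, (w - U_(i))%MM; split=> //; rewrite {1}e mdegD mdeg1.
Qed.

Lemma mpoly_decomp (A : comNzRingType) N (f : {mpoly A[N]}) :
  exists h : 'I_N -> {mpoly A[N]}, f = (f@_0)%:MP + \sum_k 'X_k * h k.
Proof.
elim/mpoly_indX: f => [c f g [hf Hf] [hg Hg]||i f _].
- exists (fun k => c *: hf k + hg k).
  under eq_bigr => k _ do rewrite mulrDr -scalerAr.
  rewrite big_split /= -scaler_sumr mcoeffD mcoeffZ mpolyCD mpolyCM mul_mpolyC.
  by rewrite addrACA -scalerDr -Hf -Hg.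
- exists (fun=> 0); rewrite big1 => [|k _]; last by rewrite mulr0.
  by rewrite rmorph1 addr0.
exists (fun k => if k == i then f else 0).
rewrite (bigD1 i) //= eqxx big1 => [|k nk]; last by rewrite (negbTE nk) mulr0.
by rewrite rmorphM /= mcoeffX mnm1_eq0 mul0r mpolyC0 add0r addr0.
Qed.

Section Relations.
Variables (C : numFieldType) (n m d : nat).
Local Notation FF := {mpoly C[ngen m d]}.

Lemma tlinX k : tlin d ('X_[gen_mon k] : {mpoly C[m]}) = 'X_k :> FF.
Proof.
rewrite /tlin (bigD1 k) //= mcoeffX eqxx scale1r big1 ?addr0 // => l nl.
by rewrite mcoeffX (inj_eq (@gen_mon_inj m d)) eq_sym (negbTE nl) scale0r.
Qed.

HB.instance Definition _ := GRing.LRMorphism.copy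
  (@phi C n m d : FF -> {mpoly C[n * m]})
  (comp_mpoly [tuple power_sum C n (gen_mon k) | k < ngen m d]).

Lemma phiX k : phi n ('X_k : FF) = power_sum C n (gen_mon k).
Proof. by rewrite /phi comp_mpolyXU -tnth_nth tnth_mktuple. Qed.

Lemma Fplus_mcoeff0 (a : FF) : Fplus a -> a@_0 = 0.
Proof.
case=> s hs ->; rewrite raddf_sum big_seq big1 // => h /hs[e e0 he].
by apply: (dhomog_nemf_coeff he); rewrite mf0 eq_sym -lt0n.
Qed.

(** An element of F+ has no constant term, hence is a combination of the variables; its coefficients
    are absorbed into the kernel. *)
Lemma Fplus_ker_gens (f : FF) : Fplus_ker n f ->
  exists b : 'I_(ngen m d) -> FF,
    (forall k, phi n (b k) = 0) /\ f = \sum_k 'X_k * b k.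
Proof.
case=> s hs ->; elim: s hs => [|[a b] s IH] hs.
  exists (fun=> 0); split=> [k|]; first exact: rmorph0.
  by rewrite big_nil big1 // => k _; rewrite mulr0.
have [|b' [kb' eb']] := IH; first by move=> ab h; apply: hs; rewrite inE h orbT.
have [/= Fa kb] := hs _ (mem_head _ _).
have [h ah] := mpoly_decomp a; rewrite Fplus_mcoeff0 // mpolyC0 add0r in ah.
exists (fun k => h k * b + b' k); split=> [k|].
  by rewrite rmorphD rmorphM /= kb kb' mulr0 addr0.
rewrite big_cons eb' /= ah mulr_suml -big_split /=; apply: eq_bigr => k _.
by rewrite mulrDr mulrA.
Qed.

End Relations.

(** * The functional that separates [J] from F+ ker(phi) *)

Section NotGenerated.
Variables (C : numFieldType) (n m : nat) (hnm : (n <= m)%N).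
Local Notation FF := {mpoly C[ngen m n]}.
Local Notation x := (@mxvec_index n m).
Local Notation P := {mpoly C[n * m]}.

(** The generic determinant is placed on the first [n] coordinates of the points; flattening the
    matrix of target indices avoids decoding [k]. *)
Definition minor_index (k : 'I_(n * n)) : 'I_(n * m) :=
  mxvec (\matrix_(a < n, j < n) x a (widen_ord hnm j)) 0 k.

Lemma minor_indexE a j : minor_index (mxvec_index a j) = x a (widen_ord hnm j).
Proof. by rewrite /minor_index mxvecE mxE. Qed.

Lemma minor_index_inj : injective minor_index.
Proof.
move=> k l; case/mxvec_indexP: k => a j; case/mxvec_indexP: l => b i.
rewrite !minor_indexE => /mxvec_index_inj[-> /(congr1 val)] /= ji.
by congr mxvec_index; apply: val_inj.
Qed.

Definition minor : P := rename minor_index (gdet C n).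
Local Notation D := minor.

Lemma minor_det :
  D = \det (\matrix_(a < n, j < n) ('X_(x a (widen_ord hnm j)) : P)).
Proof.
rewrite /minor /gdet -det_map_mx; congr (\det _).
by apply/matrixP=> a j; rewrite !mxE -minor_indexE; apply: renameXU.
Qed.

Lemma mderiv_minor a j :
  (exists2 j0, j = widen_ord hnm j0 & D^`M(x a j) = rename minor_index (gdet C n)^`M(mxvec_index a j0))
  \/ (forall b, D^`M(x b j) = 0).
Proof.
case: (ltnP j n) => [jn|nj]; [left|right=> b].
  exists (Ordinal jn); first exact: val_inj.
  rewrite -mderiv_rename; last exact: minor_index_inj.
  by rewrite minor_indexE; congr (_^`M(x a _)); apply: val_inj.
apply: mderiv_rename0 => k; case/mxvec_indexP: k => c i.
rewrite minor_indexE; apply/eqP => /mxvec_index_inj[_ /(congr1 val)] /= e.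
by have := ltn_ord i; rewrite e ltnNge nj.
Qed.

Lemma mderiv2_minor_antisym a b j j' :
  D^`M(x b j')^`M(x a j) = - D^`M(x a j')^`M(x b j).
Proof.
have [[j0 -> _]|Dj] := mderiv_minor a j; last first.
  by rewrite mderiv_comm Dj mderiv0 mderiv_comm Dj mderiv0 oppr0.
have [[j0' -> _]|Dj] := mderiv_minor b j'; last by rewrite !Dj !mderiv0 oppr0.
rewrite -!minor_indexE !mderiv_rename; try exact: minor_index_inj.
by rewrite mderiv2_gdet_antisym rmorphN.
Qed.

Lemma mderiv2_minor_row a j j' : D^`M(x a j')^`M(x a j) = 0.
Proof. by apply: (@eq_opp_eq0 C); rewrite {1}mderiv2_minor_antisym. Qed.

(* [border j] is the determinant D with its j-th column replaced by 1, ..., 1 :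
   it is invariant under simultaneous translation of the n points. *)
Definition border j : P := \sum_a D^`M(x a j).

Lemma mderiv_sum (I : finType) (F : I -> P) k :
  (\sum_i F i)^`M(k) = \sum_i (F i)^`M(k).
Proof. by rewrite (raddf_sum (mderiv k)). Qed.

(** In the double sum of second derivatives of [D], exchanging the two points changes the sign. *)
Lemma border_translation j j' : \sum_a (border j)^`M(x a j') = 0.
Proof.
under eq_bigr => a _ do rewrite mderiv_sum.
apply: (@eq_opp_eq0 C); rewrite {1}exchange_big /= -sumrN.
apply: eq_bigr => a _; rewrite -sumrN; apply: eq_bigr => b _.
exact: mderiv2_minor_antisym.
Qed.

Lemma mderiv2_border_row a j j' j'' : (border j)^`M(x a j')^`M(x a j'') = 0.
Proof.
rewrite !mderiv_sum big1 // => b _.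
rewrite (mderiv_comm (x b j) (x a j')) (mderiv_comm (x b j) (x a j'')).
by rewrite mderiv2_minor_row mderiv0.
Qed.

Definition pt_mon (i : 'I_n) (w : 'X_{1..m}) : P := \prod_(j < m) 'X_(x i j) ^+ w j.

Lemma pt_monD i w w' : pt_mon i (w + w') = pt_mon i w * pt_mon i w'.
Proof. by rewrite -big_split; apply: eq_bigr => j _; rewrite mnmDE exprD. Qed.

Lemma pt_monU i j : pt_mon i U_(j) = 'X_(x i j).
Proof.
rewrite /pt_mon (bigD1 j) //= mnm1E eqxx expr1 big1 ?mulr1 // => k nk.
by rewrite mnm1E eq_sym (negbTE nk).
Qed.

(** The map [q] of the overview. *)
Definition cut (f : FF) : FF :=
  f \mPo [tuple if mdeg (gen_mon k) == 2%N then 'X_k else 0 | k < ngen m n].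
HB.instance Definition _ := GRing.LRMorphism.copy cut
  (comp_mpoly [tuple if mdeg (gen_mon k) == 2%N then 'X_k else 0 | k < ngen m n]).

Lemma cutX k : cut 'X_k = if mdeg (gen_mon k) == 2%N then 'X_k else 0.
Proof. by rewrite /cut comp_mpolyXU -tnth_nth tnth_mktuple. Qed.

(** In degree 1 the dual operator is an infinitesimal translation, which kills both borders. In
    degree at least 3, three derivatives fall on one point, where the product of two borders has
    degree at most 2. *)
Lemma pairing_border w j j' f : (0 < mdeg w)%N -> mdeg w != 2%N ->
  pairing (border j * border j') (power_sum C n w * f) = 0.
Proof.
move=> /mnm_pop[j1 [w1 [-> ->]]].
have [/eqP w10|w10] := posnP (mdeg w1).
  rewrite mdeg_eq0 in w10; rewrite (eqP w10) addm0 mdeg0 => _.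
  have -> : power_sum C n U_(j1) = \sum_i 'X_(x i j1) by apply: eq_bigr => i _; exact: pt_monU.
  rewrite [_ * f]mulr_suml linear_sum /=.
  under eq_bigr => i _ do rewrite pairing_XM mderivM.
  rewrite -pairing_suml big_split /= -mulr_suml -mulr_sumr !border_translation.
  by rewrite mul0r mulr0 addr0 pairing0l.
case/mnm_pop: w10 => j2 [w2 [-> ->]]; rewrite eqSS eqSS -lt0n.
case/mnm_pop => j3 [w3 [-> _]].
rewrite [_ * f]mulr_suml linear_sum big1 // => i _.
rewrite -[\prod_(j < m) _]/(pt_mon i _) !pt_monD !pt_monU -!mulrA /= !pairing_XM.
rewrite !mderivM !mderivD !mderivM !mderiv2_border_row !mul0r !mulr0 add0r addr0.
by rewrite !mderivM !mderiv2_border_row !mul0r !mulr0 !addr0 pairing0l.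
Qed.

(** The generators of degree other than 2 are discarded one at a time; the arbitrary multiplier [u]
    carries the generators that are kept. *)
Lemma pairing_border_cut j j' (f : FF) u :
  pairing (border j * border j') (u * phi n (cut f))
  = pairing (border j * border j') (u * phi n f).
Proof.
elim/mpoly_indX: f u => [c f g Hf Hg||k f IH] u.
- move: (border j * border j') Hf Hg => G Hf Hg.
  have cutP (h1 h2 : FF) : cut (c *: h1 + h2) = c *: cut h1 + cut h2 by apply: linearP.
  have phiP (h1 h2 : FF) : phi n (c *: h1 + h2) = c *: phi n h1 + phi n h2.
    by apply: (linearP (comp_mpoly _)).
  have pairP (h1 h2 : P) :
      pairing G (u * (c *: h1 + h2)) = c * pairing G (u * h1) + pairing G (u * h2).
    by rewrite mulrDr -scalerAr linearP.
  transitivity (pairing G (u * (c *: phi n (cut f) + phi n (cut g)))).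
    by congr (pairing G (u * _)); rewrite cutP; apply: phiP.
  transitivity (pairing G (u * (c *: phi n f + phi n g))).
    have := Hg u; have := Hf u; rewrite !pairP.
    by move: (phi n (cut f)) (phi n f) (phi n (cut g)) (phi n g) => ? ? ? ? -> ->.
  by congr (pairing G (u * _)); apply/esym/phiP.
- by rewrite !rmorph1.
rewrite !rmorphM /= cutX; case: eqP => [_|/eqP k2].
  by rewrite mulrA IH mulrA.
rewrite rmorph0 mul0r mulr0 linear0 mulrCA phiX pairing_border //.
by case/andP: (gen_mon_bound k).
Qed.

Lemma pairing_minor : pairing (D * D) (D * D) = (gdet_norm n)%:~R.
Proof. by rewrite -rmorphM pairing_rename ?pairing_gdet //; apply: minor_index_inj. Qed.

Section RowDegree.
Variable a : 'I_n.
Definition rowdeg (w : 'X_{1..n * m}) : nat := \sum_j w (x a j).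
Lemma rowdeg0 : rowdeg 0 = 0%N.
Proof. by rewrite /rowdeg big1 // => j _; rewrite mnm0E. Qed.
Lemma rowdegD : {morph rowdeg : w w' / (w + w')%MM >-> (w + w')%N}.
Proof. by move=> w w'; rewrite /rowdeg -big_split; apply: eq_bigr => j _; rewrite mnmDE. Qed.
HB.instance Definition _ := isMeasure.Build _ rowdeg rowdeg0 rowdegD.

Lemma rowdegU b j : rowdeg U_(x b j) = (a == b).
Proof.
rewrite /rowdeg; have [<-|nab] := eqVneq a b.
  rewrite (bigD1 j) //= mnm1E eqxx big1 // => k nk.
  by rewrite mnm1E; case: eqP => // /mxvec_index_inj[_ e]; rewrite e eqxx in nk.
rewrite big1 // => k _; rewrite mnm1E; case: eqP => // /mxvec_index_inj[e _].
by rewrite e eqxx in nab.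
Qed.

(** If [e = 0] and [a = b] the derivative is zero, so the truncated subtraction is harmless. *)
Lemma mderiv_rowdeg b j e (f : P) : f \is ishomog1 e rowdeg ->
  f^`M(x b j) \is ishomog1 (e - (a == b)) rowdeg.
Proof.
move=> hf; apply/dhomogP => w; rewrite mcoeff_msupp mcoeff_deriv => nz.
have : (w + U_(x b j))%MM \in msupp f.
  by rewrite mcoeff_msupp; apply: contra nz => /eqP->; rewrite mul0rn.
by move/(dhomog_mf hf) <-; rewrite /= rowdegD rowdegU addnK.
Qed.

Lemma minor_rowdeg : D \is ishomog1 1 rowdeg.
Proof.
rewrite minor_det /determinant; apply: rpred_sum => s _.
under eq_bigr => c _ do rewrite mxE.
rewrite rpredMsign mprodXE dhomogX /= (big_morph rowdeg rowdegD rowdeg0).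
by rewrite (bigD1 a) //= rowdegU eqxx big1 // => c nc; rewrite rowdegU eq_sym (negbTE nc).
Qed.

(** Each generator kept by [cut] contributes two factors at one and the same point, so [phi (cut f)]
    has even degree at every point. Parity, unlike the exact degree, is preserved when these pairs
    of derivatives are moved onto [h]. *)
Lemma pairing_odd_rowdeg (f : FF) (h : P) :
  (forall w, h@_w != 0 -> odd (rowdeg w)) -> pairing h (phi n (cut f)) = 0.
Proof.
elim/mpoly_indX: f h => [c f1 f2 H1 H2|h Oh|k f IH h Oh].
- by move=> h Oh; rewrite !linearD !linearZ /= H1 // H2 // mulr0 addr0.
- rewrite !rmorph1 pairing1; apply/eqP; apply: contraTT isT => /Oh.
  by rewrite /= rowdeg0.
rewrite !rmorphM /= cutX; case: eqP => [k2|_]; last by rewrite rmorph0 mul0r linear0.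
have [|j [w [kw]]] := @mnm_pop _ (gen_mon k); first by rewrite k2.
rewrite k2 => -[] /esym/eqP /mdeg1P[j' /eqP wj'].
rewrite phiX kw wj' mulr_suml linear_sum big1 // => i _.
rewrite -[\prod_(_ < _) _]/(pt_mon i _) pt_monD !pt_monU -mulrA /= !pairing_XM.
apply: IH => v; rewrite !mcoeff_deriv => nz.
have /Oh : h@_(v + U_(x i j') + U_(x i j))%MM != 0.
  by apply: contra nz => /eqP ->; rewrite !mul0rn.
by rewrite !rowdegD !rowdegU !oddD; case: (odd _); case: (a == i).
Qed.

End RowDegree.

Lemma pairing_offdiag a b j j' (f : FF) : a != b ->
  pairing (D^`M(x a j) * D^`M(x b j')) (phi n (cut f)) = 0.
Proof.
move=> nab; apply: (@pairing_odd_rowdeg a) => w.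
(* Differentiating at the point [a] removes it from the first factor and leaves the second one of
   degree 1 there. *)
have /dhomogP h : D^`M(x a j) * D^`M(x b j') \is ishomog1 (0 + 1) (rowdeg a).
  apply: dhomogM.
    by have := mderiv_rowdeg a j (minor_rowdeg a); rewrite eqxx.
  by have := mderiv_rowdeg b j' (minor_rowdeg a); rewrite (negbTE nab).
by rewrite -mcoeff_msupp => /h /= ->.
Qed.

Definition cut_pairing (f : FF) : C := pairing (D * D) (phi n (cut f)).

Lemma cut_pairing_ker k (b : FF) : phi n b = 0 -> cut_pairing ('X_k * b) = 0.
Proof.
move=> kb; rewrite /cut_pairing !rmorphM /= cutX.
case: eqP => [k2|_]; last by rewrite rmorph0 mul0r linear0.
have [|j [w [kw]]] := @mnm_pop _ (gen_mon k); first by rewrite k2.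
rewrite k2 => -[] /esym/eqP /mdeg1P[j' /eqP wj'].
rewrite phiX kw wj' [power_sum C n _ * _]mulr_suml linear_sum /=.
(* Two derivatives at the point [i] must hit different factors [D], which happens in two ways. The
   terms with [a <> i] are zero and only complete the double sum. *)
have E i : pairing (D * D) ((\prod_(l < m) xij C i l ^+ (U_(j) + U_(j'))%MM l) * phi n (cut b))
    = \sum_a pairing (D^`M(x i j) * D^`M(x a j')) (phi n (cut b)) *+ 2.
  rewrite -[\prod_(_ < _) _]/(pt_mon i _) pt_monD !pt_monU -mulrA /= !pairing_XM.
  rewrite (bigD1 i) //= big1 ?addr0 => [|a nai]; last first.
    by rewrite pairing_offdiag ?mul0rn // eq_sym.
  rewrite !mderivM !mderivD !mderivM !mderiv2_minor_row mul0r mulr0 add0r addr0.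
  by rewrite mulr2n -pairingDl [X in _ + X]mulrC.
transitivity (\sum_i \sum_a pairing (D^`M(x i j) * D^`M(x a j')) (phi n (cut b)) *+ 2).
  by apply: eq_bigr => i _; apply: E.
(* The completed double sum is a product of borders, against which [cut b] may be replaced by [b]
   itself. *)
have <- : pairing (border j * border j') (phi n (cut b)) *+ 2
    = \sum_i \sum_a pairing (D^`M(x i j) * D^`M(x a j')) (phi n (cut b)) *+ 2.
  move: (phi n (cut b)) => Q; rewrite /border big_distrlr pairing_suml -sumrMnl.
  by apply: eq_bigr => i _; rewrite pairing_suml -sumrMnl.
by have := pairing_border_cut j j' b 1; rewrite !mul1r kb linear0 => ->; rewrite mul0rn.
Qed.

Lemma cut_pairing_Fplus_ker (f : FF) : Fplus_ker n f -> cut_pairing f = 0.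
Proof.
case/Fplus_ker_gens => b [kb ->].
apply: (big_ind (fun f => cut_pairing f = 0)) => [|f1 f2|k _].
- by rewrite /cut_pairing !linear0.
- by rewrite /cut_pairing !linearD /= => -> ->; rewrite addr0.
exact: cut_pairing_ker.
Qed.

End NotGenerated.

(** * Kernel membership of [J] and the value of the functional on it *)

Section JElement.
Variables (C : numFieldType) (n m : nat) (hn : (2 <= n)%N) (hnm : (n <= m)%N).
Local Notation FF := {mpoly C[ngen m n]}.
Local Notation x := (@mxvec_index n m).
Local Notation P := {mpoly C[n * m]}.
Local Notation up := (widen_ord hnm).
Local Notation D := (minor C hnm).

Lemma tlin_mon (w : 'X_{1..m}) : (0 < mdeg w <= n)%N ->
  exists2 k, gen_mon k = w & tlin n ('X_[w] : {mpoly C[m]}) = 'X_k :> FF.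
Proof. by move/gen_monP => [k <-]; exists k => //; apply: tlinX. Qed.

Lemma tlin2 j j' : exists2 k, mdeg (gen_mon k) = 2%N &
  tlin n ('X_j * 'X_j' : {mpoly C[m]}) = 'X_k :> FF
  /\ phi n ('X_k : FF) = \sum_a 'X_(x a j) * 'X_(x a j').
Proof.
rewrite -mpolyXD; have [|k kw ->] := @tlin_mon (U_(j) + U_(j'))%MM.
  by rewrite mdegD !mdeg1.
exists k; first by rewrite kw mdegD !mdeg1.
split=> //; rewrite phiX kw; apply: eq_bigr => a _.
by rewrite -[LHS]/(pt_mon C a _) pt_monD !pt_monU.
Qed.

Lemma tlin1 j : exists2 k, mdeg (gen_mon k) = 1%N &
  tlin n ('X_j : {mpoly C[m]}) = 'X_k :> FF
  /\ phi n ('X_k : FF) = \sum_a 'X_(x a j).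
Proof.
have [|k kw ->] := @tlin_mon U_(j)%MM; first by rewrite mdeg1 (ltnW hn).
exists k; first by rewrite kw mdeg1.
split=> //; rewrite phiX kw; apply: eq_bigr => a _.
by rewrite -[LHS]/(pt_mon C a _) pt_monU.
Qed.

Let Y : 'M[P]_n := \matrix_(a, j) 'X_(x a (up j)).

(* Both sides are the Gram matrix of the rows of [Y^T, 1]. *)
Lemma J_ker : phi n (J C hnm : FF) = 0.
Proof.
rewrite /J -det_map_mx map_block_mx.
(* A zero row makes the matrix [[Y, 1]] square, so that its Gram matrix has determinant 0. *)
pose M : 'M[P]_(n + 1) := block_mx Y (const_mx 1) 0 0.
rewrite [X in \det X](_ : _ = M^T *m M).
  by rewrite det_mulmx [X in _ * X]det_ublock det_mx11 mxE !mulr0.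
rewrite /M tr_block_mx mulmx_block !trmx0 !mulmx0 !addr0.
congr block_mx; apply/matrixP => i j; rewrite !mxE /=.
- have [k _ [-> ->]] := tlin2 (up i) (up j).
  by apply: eq_bigr => a _; rewrite !mxE.
- have [k _ [-> ->]] := tlin1 (up i).
  by apply: eq_bigr => a _; rewrite !mxE mulr1.
- have [k _ [-> ->]] := tlin1 (up j).
  by apply: eq_bigr => a _; rewrite !mxE mul1r.
rewrite !ord1 eqxx mulr1n rmorph_nat.
under eq_bigr => a _ do rewrite !mxE mulr1.
by rewrite sumr_const card_ord.
Qed.

(** Once the entries t(x_i) are killed the matrix is block diagonal, with the Gram matrix [Y^T Y] as
    its first block. *)
Lemma cut_J : phi n (cut (J C hnm)) = n%:R * (D * D).
Proof.
rewrite /J -!det_map_mx !map_block_mx.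
rewrite [X in \det X](_ : _ = block_mx (Y^T *m Y) 0 0 (n%:R)%:M).
  rewrite det_ublock det_scalar1 det_mulmx det_tr mulrC minor_det.
  by congr (_ * _).
congr block_mx; apply/matrixP => i j; rewrite !mxE /=.
- have [k k2 [-> Hk]] := tlin2 (up i) (up j).
  rewrite cutX k2 eqxx Hk.
  by apply: eq_bigr => a _; rewrite !mxE.
- have [k k1 [-> _]] := tlin1 (up i).
  by rewrite cutX k1 rmorph0.
- have [k k1 [-> _]] := tlin1 (up j).
  by rewrite cutX k1 rmorph0.
by rewrite !ord1 eqxx mulr1n !rmorph_nat.
Qed.

Lemma J_notin_Fplus_ker : ~ Fplus_ker n (J C hnm).
Proof.
move=> /(cut_pairing_Fplus_ker hnm) /eqP; rewrite /cut_pairing cut_J.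
rewrite mulr_natl linearMn /= pairing_minor mulrn_eq0 intr_eq0.
by rewrite (gt_eqF (gdet_norm_gt0 n)) orbF -leqn0 leqNgt (ltnW hn).
Qed.

End JElement.

(** * Two copies of the generic determinant *)

Lemma map_rename (A B : comNzRingType) (s : {rmorphism A -> B}) N M (w : 'I_N -> 'I_M) f :
  map_mpoly s (rename w f) = rename w (map_mpoly s f).
Proof.
elim/mpoly_indX: f => [c f g Hf Hg||i f Hf].
- by rewrite !(linearP (rename w)) !(rmorphD (map_mpoly s)) /= !map_mpolyZ !(linearP (rename w)) Hf Hg.
- by rewrite !rmorph1.
by rewrite !rmorphM /= Hf renameXU !map_mpolyX renameXU.
Qed.

Section TwoCopies.
Variables (A : comNzRingType) (n : nat).
Hypothesis A2 : forall a : A, a = - a -> a = 0.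
Local Notation R := {mpoly A[n * n + n * n]}.

Definition copy (b : bool) (k : 'I_(n * n)) : 'I_(n * n + n * n) :=
  if b then rshift (n * n) k else lshift (n * n) k.
Definition colvar (b : bool) (l i : 'I_n) : R := 'X_(copy b (mxvec_index l i)).
Definition det2 (b : bool) : R := rename (copy b) (gdet A n).
(** The operator det(d/dz) det(d/dz') followed by the constant term; [false] stands for z and [true]
    for z'. *)
Definition ell (f : R) : A := pairing (det2 false * det2 true) f.
HB.instance Definition _ := GRing.Linear.copy ell (pairing (det2 false * det2 true)).

Lemma copy_inj b : injective (copy b).
Proof. by case: b; [apply: rshift_inj | apply: lshift_inj]. Qed.

Lemma copy_neq b k k' : copy b k != copy (~~ b) k'.
Proof. by case: b; rewrite /= ?eq_rlshift ?eq_lrshift. Qed.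

Lemma mderiv_det2 b : forall f g k,
  (rename (copy b) f * rename (copy (~~ b)) g : R)^`M(copy b k)
  = rename (copy b) f^`M(k) * rename (copy (~~ b)) g.
Proof.
move=> f g k; rewrite mderivM (mderiv_rename f k (@copy_inj b)).
rewrite (@mderiv_rename0 _ _ _ (copy (~~ b)) g (copy b k)) ?mulr0 ?addr0 // => k'.
by rewrite eq_sym copy_neq.
Qed.

Lemma ell_anti b l i l' j f :
  ell (colvar b l i * (colvar b l' j * f)) = - ell (colvar b l' i * (colvar b l j * f)).
Proof.
rewrite /ell (_ : det2 false * det2 true = det2 b * det2 (~~ b)); last first.
  by case: b; [apply: mulrC | ].
rewrite !pairing_XM !mderiv_det2 mderiv2_gdet_antisym.
by rewrite rmorphN mulNr pairingNl.
Qed.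

(** [ell] alternates in the rows [l], [l'] of one copy while [S] is symmetric, so the sum equals its
    own negative. *)
Lemma ell_sym b i j (S : 'I_n -> 'I_n -> R) : (forall l l', S l l' = S l' l) ->
  \sum_l \sum_l' ell (colvar b l i * (colvar b l' j * S l l')) = 0.
Proof.
move=> Ss; apply: A2; rewrite {1}exchange_big /= -sumrN.
apply: eq_bigr => l _; rewrite -sumrN; apply: eq_bigr => l' _.
by rewrite ell_anti Ss.
Qed.

(** An entry of the generic matrix [g = z + z']. *)
Definition sumvar l i : R := colvar false l i + colvar true l i.

Lemma ell_ZM l i f : ell (sumvar l i * f) = \sum_b ell (colvar b l i * f).
Proof. by rewrite /sumvar mulrDl linearD big_bool addrC. Qed.

(* Among three derivations of a product of two determinants, two hit the same
   determinant. *)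
Lemma ell_sym3 i1 i2 i3 (U : 'I_n -> 'I_n -> 'I_n -> R) :
  (forall l1 l2 l3, U l1 l2 l3 = U l2 l1 l3) ->
  (forall l1 l2 l3, U l1 l2 l3 = U l1 l3 l2) ->
  \sum_l1 \sum_l2 \sum_l3 ell (sumvar l1 i1 * (sumvar l2 i2 * (sumvar l3 i3 * U l1 l2 l3))) = 0.
Proof.
move=> U12 U23.
have E l1 l2 l3 : ell (sumvar l1 i1 * (sumvar l2 i2 * (sumvar l3 i3 * U l1 l2 l3)))
    = \sum_b1 \sum_b2 \sum_b3 ell (colvar b1 l1 i1 * (colvar b2 l2 i2 * (colvar b3 l3 i3 * U l1 l2 l3))).
  rewrite ell_ZM; apply: eq_bigr => b1 _.
  rewrite mulrCA ell_ZM; apply: eq_bigr => b2 _.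
  rewrite [colvar b1 _ _ * _]mulrCA [colvar b2 _ _ * _]mulrCA ell_ZM; apply: eq_bigr => b3 _.
  congr (ell _); rewrite !mulrA; congr (_ * _).
  by rewrite [LHS]mulrC -mulrA; congr (_ * _); apply: mulrC.
under eq_bigr => l1 _ do under eq_bigr => l2 _ do under eq_bigr => l3 _ do rewrite E.
under eq_bigr => l1 _ do under eq_bigr => l2 _ do rewrite exchange_big.
under eq_bigr => l1 _ do rewrite exchange_big.
rewrite exchange_big big1 //= => b1 _.
under eq_bigr => l1 _ do under eq_bigr => l2 _ do rewrite exchange_big.
under eq_bigr => l1 _ do rewrite exchange_big.
rewrite exchange_big big1 //= => b2 _.
under eq_bigr => l1 _ do under eq_bigr => l2 _ do rewrite exchange_big.
under eq_bigr => l1 _ do rewrite exchange_big.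
rewrite exchange_big big1 //= => b3 _.
have [<-|n12] := eqVneq b1 b2.
  under eq_bigr => l1 _ do rewrite exchange_big.
  rewrite exchange_big big1 //= => l3 _.
  by apply: (ell_sym b1 i1 i2 (S := fun l1 l2 => colvar b3 l3 i3 * U l1 l2 l3)) => l l'; rewrite U12.
have [<-|n13] := eqVneq b1 b3.
  rewrite exchange_big big1 //= => l2 _.
  under eq_bigr => l1 _ do under eq_bigr => l3 _ do rewrite [colvar b2 l2 i2 * _]mulrCA.
  apply: (ell_sym b1 i1 i3 (S := fun l1 l3 => colvar b2 l2 i2 * U l1 l2 l3)) => l l'.
  by rewrite U23 U12 U23.
have <- : b2 = b3 by case: b1 b2 b3 n12 n13 => -[] [].
rewrite big1 //= => l1 _.
under eq_bigr => l2 _ do under eq_bigr => l3 _ do rewrite [colvar b1 l1 i1 * _]mulrCA [colvar b1 l1 i1 * _]mulrCA.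
apply: (ell_sym b2 i2 i3 (S := fun l2 l3 => colvar b1 l1 i1 * U l1 l2 l3)) => l l'.
by rewrite U23.
Qed.

(** The entry [(i, j)] of [g^T S g]. *)
Definition quadform (S : 'M[A]_n) i j : R :=
  \sum_l \sum_l' sumvar l i * (sumvar l' j * (S l l')%:MP).

(** The entry [(i, j)] of [z^T S z']. *)
Definition bilin (S : 'M[A]_n) i j : R :=
  \sum_l \sum_l' colvar false l i * (colvar true l' j * (S l l')%:MP).

Lemma ell_suml2 (F G : 'I_n -> 'I_n -> R) f :
  (forall l l', ell (F l l' * f) = ell (G l l' * f)) ->
  ell ((\sum_l \sum_l' F l l') * f) = ell ((\sum_l \sum_l' G l l') * f).
Proof.
move=> FG; rewrite !mulr_suml !linear_sum; apply: eq_bigr => l _.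
by rewrite !mulr_suml !linear_sum; apply: eq_bigr => l' _; apply: FG.
Qed.

Lemma ell_mul_sum2 (F : 'I_n -> 'I_n -> R) f :
  ell ((\sum_l \sum_l' F l l') * f) = \sum_l \sum_l' ell (F l l' * f).
Proof.
rewrite mulr_suml linear_sum; apply: eq_bigr => l _.
by rewrite mulr_suml linear_sum.
Qed.

Lemma ell_ZZM l i l' j f : ell (sumvar l i * (sumvar l' j * f))
  = (ell (colvar false l i * (colvar false l' j * f)) + ell (colvar true l i * (colvar true l' j * f)))
    + (ell (colvar false l i * (colvar true l' j * f)) + ell (colvar false l' j * (colvar true l i * f))).
Proof.
rewrite /sumvar !mulrDl !mulrDr !linearD /= [colvar true l i * (colvar false l' j * f)]mulrCA.
by rewrite [X in _ + X = _]addrC addrACA.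
Qed.

(** When [g = z + z'] is expanded, the parts quadratic in one copy vanish by [ell_sym]; only the two
    mixed parts survive. *)
Lemma ell_gam (S : 'M[A]_n) i j f : S^T = S ->
  ell (quadform S i j * f) = ell (bilin S i j * f) + ell (bilin S j i * f).
Proof.
move=> ST; have Ss l l' : S l l' = S l' l by rewrite -{1}ST mxE.
rewrite !ell_mul_sum2 [X in _ + X]exchange_big /= -big_split /=.
transitivity (\sum_l \sum_l' ((ell (colvar false l i * (colvar false l' j * ((S l l')%:MP * f)))
    + ell (colvar true l i * (colvar true l' j * ((S l l')%:MP * f))))
    + (ell (colvar false l i * (colvar true l' j * (S l l')%:MP) * f)
       + ell (colvar false l' j * (colvar true l i * (S l' l)%:MP) * f)))).
  apply: eq_bigr => l _; apply: eq_bigr => l' _.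
  by rewrite -!mulrA ell_ZZM (Ss l' l).
etransitivity; first by apply: eq_bigr => l _; rewrite !big_split.
rewrite !big_split /= !ell_sym ?add0r //; last 2 first.
- by move=> l l'; rewrite Ss.
- by move=> l l'; rewrite Ss.
Qed.

End TwoCopies.

Lemma mx_scalerI (R : idomainType) m n (a : R) : a != 0 -> injective ( *:%R a : 'M_(m, n) -> _).
Proof.
move=> na M N /matrixP e; apply/matrixP => i j.
by apply: (mulfI na); have := e i j; rewrite !mxE.
Qed.

(** This is adj(P T Q) = adj(Q) adj(T) adj(P) in disguise, obtained by cancelling the nonzero
    determinants of [P] and [T]. *)
Lemma adj_conj (R : idomainType) n (P T Q : 'M[R]_n) : \det P != 0 -> \det T != 0 ->
  Q *m \adj (P *m T *m Q) *m P = (\det P * \det Q) *: \adj T.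
Proof.
move=> nP nT; set M := P *m T *m Q.
have nPT : \det P * \det T != 0 by rewrite mulf_neq0.
have e : (P *m T) *m (Q *m \adj M) = (\det P * \det T * \det Q)%:M.
  by rewrite mulmxA mul_mx_adj !det_mulmx.
have {}e : (\det P * \det T) *: (Q *m \adj M) = (\det P * \det T * \det Q) *: \adj (P *m T).
  rewrite -[RHS]mul_mx_scalar -e -mul_scalar_mx -det_mulmx -mul_adj_mx.
  by rewrite -[LHS]mulmxA.
have adjPT : \adj (P *m T) *m P = \det P *: \adj T.
  have : \adj (P *m T) *m P *m T *m \adj T = (\det P * \det T) *: \adj T.
    by rewrite -[_ *m P *m T]mulmxA mul_adj_mx det_mulmx mul_scalar_mx.
  rewrite -[_ *m T *m _]mulmxA mul_mx_adj mul_mx_scalar mulrC -scalerA.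
  by move/(mx_scalerI nT).
apply: (mx_scalerI nPT); rewrite scalemxAl e -scalemxAl adjPT !scalerA; congr (_ *: _).
by rewrite -!mulrA; congr (_ * (_ * _)); rewrite mulrC.
Qed.

(** * Products of the mixed forms [z^T S z'] and the polarised determinant *)

Section Alternation.
Variables (A : comNzRingType) (n : nat).
Hypothesis A2 : forall a : A, a = - a -> a = 0.
Local Notation R := {mpoly A[n * n + n * n]}.
Implicit Types f : R.
Local Notation colvar := (@colvar A n).
Local Notation ell := (@ell A n).

Lemma ell_qq S S' i j i' j' f : ell (bilin S i j * (bilin S' i' j' * f)) =
  \sum_l \sum_l' \sum_k \sum_k' ell (colvar false l i * (colvar false k i' *
    (colvar true l' j * (colvar true k' j' * ((S l l')%:MP * ((S' k k')%:MP * f)))))).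
Proof.
have E (a b c d e h : R) : b * (e * c) * (a * (d * h) * f) = a * (b * (d * (e * (h * (c * f))))).
  by ring.
rewrite ell_mul_sum2; apply: eq_bigr => l _; apply: eq_bigr => l' _.
rewrite mulrCA ell_mul_sum2; apply: eq_bigr => k _; apply: eq_bigr => k' _.
by rewrite E.
Qed.

(** The indices [i] and [i'] are columns of the same copy, in which [ell] alternates whatever [S]
    and [S'] are. *)
Lemma ell_q_anti1 S S' i j i' j' f :
  ell (bilin S i j * (bilin S' i' j' * f)) = - ell (bilin S i' j * (bilin S' i j' * f)).
Proof.
rewrite !ell_qq -sumrN; apply: eq_bigr => l _; rewrite -sumrN; apply: eq_bigr => l' _.
rewrite -sumrN; apply: eq_bigr => k _; rewrite -sumrN; apply: eq_bigr => k' _.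
by rewrite ell_anti mulrCA.
Qed.

Lemma ell_q_anti2 S S' i j i' j' f :
  ell (bilin S i j * (bilin S' i' j' * f)) = - ell (bilin S i j' * (bilin S' i' j * f)).
Proof.
rewrite !ell_qq -sumrN; apply: eq_bigr => l _; rewrite -sumrN; apply: eq_bigr => l' _.
rewrite -sumrN; apply: eq_bigr => k _; rewrite -sumrN; apply: eq_bigr => k' _.
have E (a b c d e : R) : a * (b * (c * (d * e))) = c * (d * (a * (b * e))).
  by ring.
by rewrite E ell_anti; congr (- ell _); rewrite E; congr (_ * (_ * _)); apply: mulrCA.
Qed.

(** For [i] and [j] the identity this is the full polarisation of the determinant at the matrices
    [S k]. *)
Definition ellq (S : 'I_n -> 'M[A]_n) (i j : 'I_n -> 'I_n) : A :=
  ell (\prod_k bilin (S k) (i k) (j k)).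

Lemma eq_ellq S S' i i' j j' : S =1 S' -> i =1 i' -> j =1 j' -> ellq S i j = ellq S' i' j'.
Proof. by move=> eS ei ej; congr (ell _); apply: eq_bigr => k _; rewrite eS ei ej. Qed.

Lemma ellq_tperm1 S i j a b : a != b ->
  ellq S (i \o tperm a b) j = - ellq S i j.
Proof.
move=> nab; rewrite /ellq (bigD1 a) //= (bigD1 b) /=; last by rewrite eq_sym.
rewrite [in RHS](bigD1 a) //= [in RHS](bigD1 b) /=; last by rewrite eq_sym.
rewrite ell_q_anti1 tpermL tpermR; congr (- ell (_ * (_ * _))).
by apply: eq_bigr => k /andP[ka kb]; rewrite tpermD // eq_sym.
Qed.

Lemma ellq_tperm2 S i j a b : a != b ->
  ellq S i (j \o tperm a b) = - ellq S i j.
Proof.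
move=> nab; rewrite /ellq (bigD1 a) //= (bigD1 b) /=; last by rewrite eq_sym.
rewrite [in RHS](bigD1 a) //= [in RHS](bigD1 b) /=; last by rewrite eq_sym.
rewrite ell_q_anti2 tpermL tpermR; congr (- ell (_ * (_ * _))).
by apply: eq_bigr => k /andP[ka kb]; rewrite tpermD // eq_sym.
Qed.

Lemma alternating_perm (F : ('I_n -> 'I_n) -> A) :
  (forall i i', i =1 i' -> F i = F i') ->
  (forall i a b, a != b -> F (i \o tperm a b) = - F i) ->
  forall i (s : 'S_n), F (i \o s) = (-1) ^+ s * F i.
Proof.
move=> eF aF i s; case: (prod_tpermP s) => ts -> {s}.
elim: ts => [|[a b] ts IH] /=.
  by rewrite big_nil odd_perm1 mul1r => _; apply: eF => k /=; rewrite perm1.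
case/andP=> nab dts; rewrite big_cons odd_permM odd_tperm nab signr_addb mulN1r mulNr.
rewrite -IH // -(aF _ a b nab); apply: eF => k /=.
by rewrite permM.
Qed.

Lemma ellq_perm1 S i j (s : 'S_n) : ellq S (i \o s) j = (-1) ^+ s * ellq S i j.
Proof.
apply: (alternating_perm (F := fun i => ellq S i j)) => [i1 i2 e|i' a b].
  exact: eq_ellq.
exact: ellq_tperm1.
Qed.

Lemma ellq_perm2 S i j (s : 'S_n) : ellq S i (j \o s) = (-1) ^+ s * ellq S i j.
Proof.
apply: (alternating_perm (F := fun j => ellq S i j)) => [i1 i2 e|i' a b].
  exact: eq_ellq.
exact: ellq_tperm2.
Qed.

(** Alternation in [i] and in [j] gives 0 unless both are permutations, and otherwise the product of
    their signs. *)
Lemma ellq_std S i j : exists c : int, ellq S i j = c%:~R * ellq S id id.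
Proof.
have [/injectiveP ii|/injectivePn[a [b nab e]]] := boolP (injectiveb i); last first.
  exists 0; rewrite mul0r; apply: A2; rewrite -(ellq_tperm1 S i j nab).
  by apply: eq_ellq => // k /=; case: (tpermP a b k) => [->|->|].
have [/injectiveP jj|/injectivePn[a [b nab e]]] := boolP (injectiveb j); last first.
  exists 0; rewrite mul0r; apply: A2; rewrite -(ellq_tperm2 S i j nab).
  by apply: eq_ellq => // k /=; case: (tpermP a b k) => [->|->|].
exists ((-1) ^+ perm ii * (-1) ^+ perm jj).
rewrite rmorphM !rmorph_sign -mulrA -ellq_perm2 -ellq_perm1.
by apply: eq_ellq => // k /=; rewrite permE.
Qed.

Definition qmat (S : 'M[A]_n) : 'M[R]_n := \matrix_(i, j) bilin S i j.
Definition Xmat b : 'M[R]_n := \matrix_(l, i) colvar b l i.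

Lemma det_Xmat b : \det (Xmat b) = det2 A n b.
Proof.
rewrite /det2 /gdet -det_map_mx; congr (\det _).
by apply/matrixP => l i; rewrite !mxE; apply/esym/renameXU.
Qed.

Lemma qmatE S : qmat S = (Xmat false)^T *m map_mx (@mpolyC _ A) S *m Xmat true.
Proof.
apply/matrixP => i j; rewrite mxE [RHS]mxE.
under [RHS]eq_bigr => l' _ do rewrite mxE mulr_suml.
rewrite exchange_big; apply: eq_bigr => l _; apply: eq_bigr => l' _.
by rewrite !mxE -mulrA; congr (_ * _); rewrite mulrC.
Qed.

Definition det2_norm : A := ell (det2 A n false * det2 A n true).

(** The determinant of [z^T T z'] is evaluated in two ways: as a product of determinants, and by the
    Leibniz formula, whose [n!] terms agree by alternation. *)
Lemma ell_detE (T : 'M[A]_n) : \det T * det2_norm = (n`!)%:R * ellq (fun=> T) id id.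
Proof.
have <- : ell (\det (qmat T)) = \det T * det2_norm.
  rewrite qmatE !det_mulmx det_tr !det_Xmat det_map_mx mulrAC mulrC mul_mpolyC.
  by rewrite linearZ.
rewrite /determinant linear_sum /= -card_Sn mulr_natl -sumr_const.
apply: eq_big => // s _.
have -> (b : bool) f : ell ((-1) ^+ b * f) = (-1) ^+ b * ell f.
  by rewrite !mulr_sign; case: b; rewrite ?linearN.
under eq_bigr => k _ do rewrite mxE.
by rewrite -[X in _ * X]/(ellq (fun=> T) id (id \o s)) ellq_perm2 mulrA -signr_addb addbb mul1r.
Qed.

(* The matrix family equal to [S] in position [a] and to [T] elsewhere. *)
Definition one_at (S T : 'M[A]_n) (a k : 'I_n) : 'M[A]_n := if k == a then S else T.

(** Permuting both index families by one transposition moves [S] to the other position at the cost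
    of two signs, which cancel. *)
Lemma ellq_one_at S T a b : ellq (one_at S T a) id id = ellq (one_at S T b) id id.
Proof.
have [->//|nab] := eqVneq a b.
transitivity (ellq (one_at S T b) (id \o tperm a b) (id \o tperm a b)); last first.
  by rewrite ellq_tperm1 // ellq_tperm2 // opprK.
rewrite /ellq (reindex_inj (@perm_inj _ (tperm a b))); congr (ell _).
apply: eq_bigr => k _; congr (bilin _ _ _); rewrite /one_at.
by rewrite (can2_eq (tpermK a b) (tpermK a b)) tpermL.
Qed.

End Alternation.

Section AdjugatePairing.
Variables (A : idomainType) (n : nat).
Local Notation R := {mpoly A[n * n + n * n]}.
Local Notation ell := (@ell A n).

Lemma det2_neq0 b : det2 A n b != 0.
Proof.
(* The point where both copies are the identity matrix. *)
pose v (k' : 'I_(n * n + n * n)) :=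
  mxvec (1%:M : 'M[A]_n) 0 (match split k' with inl k => k | inr k => k end).
apply/eqP => D0; have : (det2 A n b).@[v] = 1.
  rewrite -(det1 A n) -meval_gdet /det2 /rename comp_mpoly_meval.
  apply: meval_eq => k; rewrite tnth_mktuple mevalXU /v.
  by case: (b); rewrite /copy; [have := unsplitK (inr k) | have := unsplitK (inl k)] => /= ->.
by move/eqP; rewrite D0 meval0 eq_sym oner_eq0.
Qed.

(** The trace of [z^T S z'] against the adjugate of [z^T T z'] is evaluated in two ways: through
    [adj_conj], and by expanding the cofactors, which gives one polarised term for each of the [n]
    positions of [S] and each of the [n!] permutations. *)
Lemma ell_adjE (S T : 'M[A]_n) a : \det T != 0 ->
  \tr (S *m \adj T) * det2_norm A n = (n * n`!)%:R * ellq (one_at S T a) id id.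
Proof.
move=> nT.
have <- : ell (\sum_i \sum_j bilin S i j * cofactor (qmat T) i j) = \tr (S *m \adj T) * det2_norm A n.
  transitivity (ell (\tr (qmat S *m \adj (qmat T)))).
    congr (ell _); rewrite /mxtrace; apply: eq_bigr => i _; rewrite mxE.
    by apply: eq_bigr => j _; rewrite !mxE.
  rewrite !qmatE; set P := (Xmat A n false)^T; set Q := Xmat A n true.
  rewrite -[P *m _ *m Q *m _]mulmxA -[P *m _ *m _]mulmxA mxtrace_mulC
     -[_ *m _ *m P]mulmxA.
  rewrite adj_conj ?det_tr ?det_Xmat ?det2_neq0 //; last first.
    by rewrite det_map_mx mpolyC_eq0.
  rewrite -scalemxAr mxtraceZ -map_mx_adj -map_mxM trace_map_mx mulrC mul_mpolyC.
  by rewrite linearZ.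
transitivity (\sum_(i < n) (n`!)%:R * ellq (one_at S T i) id id).
  rewrite linear_sum; apply: eq_bigr => i _.
  transitivity (\sum_(s : 'S_n) ell ((-1) ^+ s * \prod_k bilin (one_at S T i k) k (s k))).
    rewrite linear_sum [RHS](partition_big (fun s : 'S_n => s i) xpredT) //=.
    apply: eq_bigr => j _; rewrite expand_cofactor mulr_sumr linear_sum.
    apply: eq_bigr => s /eqP sij; congr (ell _); rewrite mulrCA; congr (_ * _).
    rewrite [RHS](bigD1 i) //= {1}/one_at eqxx sij; congr (_ * _).
    apply: eq_big => [k|k ik]; first by rewrite eq_sym.
    by rewrite mxE /one_at eq_sym (negbTE ik).
  rewrite -card_Sn mulr_natl -sumr_const; apply: eq_big => // s _.
  have -> (b : bool) f : ell ((-1) ^+ b * f) = (-1) ^+ b * ell f.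
    by rewrite !mulr_sign; case: b; rewrite ?linearN.
  rewrite -[X in _ * X]/(ellq (one_at S T i) id (id \o s)) ellq_perm2 mulrA.
  by rewrite -signr_addb addbb mul1r.
under eq_bigr => i _ do rewrite (ellq_one_at _ _ i a).
by rewrite sumr_const card_ord natrM -mulrA [RHS]mulr_natl.
Qed.

End AdjugatePairing.

Lemma det2_normE (A : comNzRingType) n : det2_norm A n = (det2_norm int n)%:~R.
Proof.
pose s : {rmorphism int -> A} := intmul 1.
have E b : map_mpoly s (det2 int n b) = det2 A n b by rewrite /det2 map_rename map_gdet.
have E2 : map_mpoly s (det2 int n false * det2 int n true) = det2 A n false * det2 A n true.
  by apply: etrans (rmorphM _ _ _) _; congr (_ * _); apply: E.
by rewrite -[RHS]/(s _) /det2_norm /ell -(pairing_map s) E2.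
Qed.

Lemma eq_scale (C : numFieldType) (A : lalgType C) (x y : A) (z : int) (N : nat) :
  (0 < N)%N -> x * z%:~R = N%:R * y -> y = (z%:~R / N%:R : C) *: x.
Proof.
move=> N0 e; have nN : N%:R != 0 :> C by rewrite pnatr_eq0 -lt0n.
apply: (scalerI nN); rewrite scaler_nat -[y *+ N]mulr_natl -e scalerA mulrCA divff // mulr1.
by rewrite mulrzr scaler_int.
Qed.

Lemma intr_mulZ (C : numFieldType) (A : lalgType C) (z : int) (a : C) (x : A) :
  z%:~R * (a *: x) = (z%:~R * a) *: x.
Proof. by rewrite mulrzl -scaler_int scalerA. Qed.

(** Column elimination with the adjugate in place of the inverse costs a factor [\det T], which is
    cancelled at the end. *)
Lemma det_bordered (R : idomainType) n (T : 'M[R]_n) (s : 'cV_n) (x : R) : \det T != 0 ->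
  \det (block_mx T s s^T x%:M : 'M_(n + 1)) = x * \det T - \tr (s *m s^T *m \adj T).
Proof.
move=> nT; apply: (mulIf nT).
have e : block_mx T s s^T x%:M *m block_mx 1%:M (- (\adj T *m s)) 0 (\det T)%:M
  = block_mx T 0 s^T (x * \det T - \tr (s *m s^T *m \adj T))%:M :> 'M_(n + 1).
  rewrite mulmx_block !mulmx1 !mulmx0 !addr0; congr block_mx.
    by rewrite mulmxN mulmxA mul_mx_adj mul_scalar_mx mul_mx_scalar addNr.
  rewrite mulmxN -scalar_mxM -mulmxA mxtrace_mulC -mulmxA trace_mx11 addrC.
  by rewrite raddfB /= -mx11_scalar.
have := congr1 determinant e; rewrite det_mulmx det_ublock det1 mul1r det_lblock.
by rewrite !det_scalar1 mulrC [RHS]mulrC => ->; rewrite mulrC.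
Qed.

Section HomogEll.
Variables (A : comNzRingType) (n : nat).
Local Notation R := {mpoly A[n * n + n * n]}.
Definition is_hom d (f : R) := f \is ishomog1 d (@mdeg (n * n + n * n)).

Lemma det2_homog b : is_hom n (det2 A n b).
Proof.
rewrite /is_hom -det_Xmat /determinant; apply: rpred_sum => s _; rewrite rpredMsign.
under eq_bigr => c _ do rewrite mxE /colvar.
rewrite mprodXE dhomogX /= mdeg_sum (eq_bigr (fun=> 1%N)) => [|c _]; last exact: mdeg1.
by rewrite sum1_card card_ord.
Qed.

Lemma ell_homog d (f : R) : is_hom d f -> d != (n + n)%N -> ell f = 0.
Proof. by move=> hf; apply: pairing_homog hf _; apply: dhomogM; apply: det2_homog. Qed.

Lemma Z_homog l i : is_hom 1 (sumvar A l i).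
Proof. by rewrite /is_hom; apply: rpredD; rewrite dhomogX /= mdeg1. Qed.

Lemma ZC_homog l i (c : A) : is_hom 1 (sumvar A l i * c%:MP).
Proof. by rewrite /is_hom mulrC mul_mpolyC; apply: rpredZ; apply: Z_homog. Qed.

Lemma gam_homog (S : 'M[A]_n) i j : is_hom 2 (quadform S i j).
Proof.
rewrite /is_hom; apply: rpred_sum => l _; apply: rpred_sum => l' _.
by rewrite -[2%N]/(1 + 1)%N; apply: dhomogM; [apply: Z_homog | apply: ZC_homog].
Qed.

Lemma q_homog (S : 'M[A]_n) i j : is_hom 2 (bilin S i j).
Proof.
rewrite /is_hom; apply: rpred_sum => l _; apply: rpred_sum => l' _.
rewrite mulrA mulrC mul_mpolyC; apply: rpredZ.
by rewrite -[2%N]/(1 + 1)%N; apply: dhomogM; rewrite dhomogX /= mdeg1.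
Qed.

Lemma prod_homog (I : Type) (r : seq I) (F : I -> R) d : (forall i, is_hom d (F i)) ->
  is_hom (d * size r) (\prod_(i <- r) F i).
Proof.
move=> hF; elim: r => [|i r IH]; first by rewrite big_nil muln0; apply: dhomog1.
by rewrite big_cons /= mulnS; apply: dhomogM; [apply: hF | apply: IH].
Qed.

(** [ell_gam] makes the factors mixed one at a time, each splitting into two orientations, while [U]
    collects the finished ones; [P] has to be closed under sums only. *)
Lemma ell_gam_list (T : 'M[A]_n) (Q : seq ('I_n * 'I_n)) (P : A -> Prop) U :
  (forall a : A, a = - a -> a = 0) -> T^T = T -> (forall a b, P a -> P b -> P (a + b)) ->
  (forall Q', size Q' = size Q -> P (ell (U * \prod_(t <- Q') bilin T t.1 t.2))) ->
  P (ell (U * \prod_(t <- Q) quadform T t.1 t.2)).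
Proof.
move=> A2 TT PD; elim: Q U => [|[i j] Q IH] U HU; first by have := HU [::]; rewrite !big_nil; apply.
rewrite big_cons mulrCA (ell_gam A2) //; apply: PD.
  rewrite mulrCA mulrA; apply: IH => Q' sQ'.
  by have := HU ((i, j) :: Q'); rewrite big_cons mulrA /= sQ'; apply.
rewrite mulrCA mulrA; apply: IH => Q' sQ'.
by have := HU ((j, i) :: Q'); rewrite big_cons mulrA /= sQ'; apply.
Qed.

Lemma ell_q_list (d : 'M[A]_n * 'I_n * 'I_n) (L : seq ('M[A]_n * 'I_n * 'I_n)) :
  size L = n ->
  ell (\prod_(t <- L) bilin t.1.1 t.1.2 t.2)
  = ellq (fun k => (nth d L k).1.1) (fun k => (nth d L k).1.2) (fun k => (nth d L k).2).
Proof. by move=> sL; rewrite (big_nth d) sL big_mkord. Qed.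

Definition lin (s : 'cV[A]_n) i : R := \sum_l sumvar A l i * (s l 0)%:MP.

Lemma linM s i j : lin s i * lin s j = quadform (s *m s^T) i j.
Proof.
rewrite /lin mulr_suml; apply: eq_bigr => l _; rewrite mulr_sumr; apply: eq_bigr => l' _.
rewrite !mxE big_ord1 mxE mpolyCM -!mulrA; congr (_ * _).
by rewrite mulrCA.
Qed.

Lemma lin_homog s i : is_hom 1 (lin s i).
Proof. by rewrite /is_hom; apply: rpred_sum => l _; apply: ZC_homog. Qed.

Lemma lin3 s i1 i2 i3 f : (forall a : A, a = - a -> a = 0) ->
  ell (lin s i1 * (lin s i2 * (lin s i3 * f))) = 0.
Proof.
move=> A2; rewrite -[RHS](ell_sym3 A2 i1 i2 i3 (U := fun l1 l2 l3 =>
   (s l1 0)%:MP * ((s l2 0)%:MP * ((s l3 0)%:MP * f)))); last 2 first.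
- by move=> l1 l2 l3; rewrite mulrCA.
- by move=> l1 l2 l3; congr (_ * _); rewrite mulrCA.
have linE i f' : ell (lin s i * f') = \sum_l ell (sumvar A l i * ((s l 0)%:MP * f')).
  rewrite /lin mulr_suml linear_sum; apply: eq_bigr => l _.
  by rewrite -mulrA.
have swap (a b c d : R) : a * (b * (c * d)) = c * (a * (b * d)) by ring.
have swap2 (a b c d e h : R) :
  a * (b * (c * (d * (e * h)))) = e * (a * (b * (c * (d * h)))) by ring.
rewrite linE; apply: eq_bigr => l1 _.
rewrite (swap _ _ (lin s i2)) linE; apply: eq_bigr => l2 _.
rewrite (swap2 _ _ _ _ (lin s i3)) linE; apply: eq_bigr => l3 _.
by congr (ell _); ring.
Qed.

End HomogEll.

(** * The plane spanned by det(T) and [s^T adj(T) s] *)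

Section QuadraticPart.
Variables (C : numFieldType) (K n : nat) (hn : (0 < n)%N).
Local Notation A := {mpoly C[K]}.
Local Notation R := {mpoly A[n * n + n * n]}.
Variables (T : 'M[A]_n) (s : 'cV[A]_n).
Hypotheses (TT : T^T = T) (nT : \det T != 0).

Let A2 (a : A) : a = - a -> a = 0. Proof. exact: (@eq_opp_eq0 C). Qed.
Let SS := s *m s^T.

(** The second generator is [s^T adj(T) s], written as a trace to match [ell_adjE]. *)
Definition in_plane (a : A) :=
  exists c1 c2 : C, a = c1 *: \det T + c2 *: \tr (SS *m \adj T).

Lemma in_planeD a b : in_plane a -> in_plane b -> in_plane (a + b).
Proof.
case=> [c1 [c2 ->]] [d1 [d2 ->]]; exists (c1 + d1), (c2 + d2).
by rewrite addrACA !scalerDl.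
Qed.

Lemma in_plane0 : in_plane 0.
Proof. by exists 0, 0; rewrite !scale0r addr0. Qed.

(** Alternation reduces [n] factors to the polarised determinant at [T]; any other number of factors
    has the wrong degree for [ell]. *)
Lemma ell_q_plane (Q : seq ('I_n * 'I_n)) :
  in_plane (ell (1 * \prod_(t <- Q) bilin T t.1 t.2)).
Proof.
rewrite mul1r; have [sQ|nQ] := eqVneq (size Q) n; last first.
  rewrite (@ell_homog _ _ (2 * size Q)); first exact: in_plane0.
    by apply: prod_homog => t; apply: q_homog.
  by rewrite addnn -mul2n eqn_mul2l.
pose d : 'M[A]_n * 'I_n * 'I_n := (T, Ordinal hn, Ordinal hn).
have := @ell_q_list _ _ d [seq (T, t.1, t.2) | t <- Q].
rewrite size_map big_map /= => -> //.
have [c ->] := ellq_std A2 (fun k => (nth d [seq (T, t.1, t.2) | t <- Q] k).1.1)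
  (fun k => (nth d [seq (T, t.1, t.2) | t <- Q] k).1.2)
  (fun k => (nth d [seq (T, t.1, t.2) | t <- Q] k).2).
rewrite (@eq_ellq _ _ _ (fun=> T) id id id id) => [|k||] //; last first.
  by rewrite (nth_map (Ordinal hn, Ordinal hn)) // sQ.
have := ell_detE T; rewrite det2_normE => /(eq_scale (fact_gt0 n)) ->.
by rewrite intr_mulZ; eexists _, 0; rewrite scale0r addr0.
Qed.

Lemma ell_qq_plane i j (Q : seq ('I_n * 'I_n)) :
  in_plane (ell (bilin SS i j * \prod_(t <- Q) bilin T t.1 t.2)).
Proof.
have [sQ|nQ] := eqVneq (size Q).+1 n; last first.
  rewrite (@ell_homog _ _ (2 + 2 * size Q)); first exact: in_plane0.
    by apply: dhomogM; [apply: q_homog | apply: prod_homog => t; apply: q_homog].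
  by rewrite addnn -mul2n -mulnS eqn_mul2l.
pose d : 'M[A]_n * 'I_n * 'I_n := (T, Ordinal hn, Ordinal hn).
pose L := (SS, i, j) :: [seq (T, t.1, t.2) | t <- Q].
have := @ell_q_list _ _ d L.
rewrite big_cons big_map /= size_map => -> //.
have [c ->] := ellq_std A2 (fun k => (nth d L k).1.1) (fun k => (nth d L k).1.2)
  (fun k => (nth d L k).2).
rewrite (@eq_ellq _ _ _ (one_at SS T (Ordinal hn)) id id id id) => [|k||] //; last first.
  rewrite /one_at -(inj_eq val_inj) /=; case: (nat_of_ord k) (ltn_ord k) => //= k'.
  move=> kn; rewrite (nth_map (Ordinal hn, Ordinal hn)) //.
  by have := kn; rewrite -[X in (_ < X)%N -> _]sQ ltnS.
have N0 : (0 < n * n`!)%N by rewrite muln_gt0 hn fact_gt0.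
have := ell_adjE SS (Ordinal hn) nT; rewrite det2_normE => /(eq_scale N0) ->.
by rewrite intr_mulZ; eexists 0, _; rewrite scale0r add0r.
Qed.

Lemma SS_sym : SS^T = SS.
Proof. by rewrite /SS trmx_mul trmxK. Qed.

(** Without linear factors only det(T) can occur; one linear factor makes the degree odd; two
    combine into the form of [s s^T]; three or more vanish by [lin3]. *)
Lemma ell_lin_gam (L : seq 'I_n) (Q : seq ('I_n * 'I_n)) :
  in_plane (ell (\prod_(i <- L) lin s i * \prod_(t <- Q) quadform T t.1 t.2)).
Proof.
case: L => [|i [|j [|k L]]].
- by rewrite big_nil; apply: (ell_gam_list A2) => // [|Q' _]; [apply: in_planeD | apply: ell_q_plane].
- rewrite big_seq1 (@ell_homog _ _ (1 + 2 * size Q)); first exact: in_plane0.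
    by apply: dhomogM; [apply: lin_homog | apply: prod_homog => t; apply: gam_homog].
  by apply: contraTneq isT => /(congr1 odd); rewrite mul2n addnn oddD !odd_double.
- rewrite big_cons big_seq1 linM (ell_gam A2) ?SS_sym //.
  by apply: in_planeD; apply: (ell_gam_list A2) => //;
    by [apply: in_planeD | move=> Q' _; apply: ell_qq_plane].
by rewrite !big_cons -!mulrA lin3 //; apply: in_plane0.
Qed.

End QuadraticPart.

(** * The Omega process *)

Definition letters n (w : 'X_{1..n}) : seq 'I_n :=
  flatten [seq nseq (w i) i | i <- enum 'I_n].

Lemma prod_letters (A : comNzRingType) n (w : 'X_{1..n}) (F : 'I_n -> A) :
  \prod_(i <- letters w) F i = \prod_i F i ^+ w i.
Proof.
rewrite big_flatten big_map big_enum; apply: eq_bigr => i _.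
by rewrite big_nseq; elim: (w i) => //= k ->; rewrite exprS.
Qed.

Lemma size_letters n (w : 'X_{1..n}) : size (letters w) = mdeg w.
Proof.
rewrite mdegE size_flatten /shape -map_comp sumnE big_map big_enum /=.
by apply: eq_bigr => i _; rewrite size_nseq.
Qed.

Lemma ellZ (A : comNzRingType) n (a : A) f : @ell A n (a *: f) = a * ell f.
Proof. exact: linearZ. Qed.

Section GenericTensor.
Variables (C : nzRingType) (A : comNzRingType) (n : nat) (tl : {mpoly C[n]} -> A).
Local Notation R := {mpoly A[n * n + n * n]}.

(** The image under [tl] of [p] times the product of the forms [g x_i] for [i] in [L], with the
    entries of the generic [g] pulled out; [p] accumulates the letters chosen so far. *)
Fixpoint tgen (L : seq 'I_n) (p : {mpoly C[n]}) : R :=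
  if L is i :: L' then \sum_l sumvar A l i * tgen L' (p * 'X_l) else (tl p)%:MP.

Lemma tgen1 i : tgen [:: i] 1 = lin (\col_l tl 'X_l) i.
Proof. by apply: eq_bigr => l _; rewrite mxE /= mul1r. Qed.

Lemma tgen2 i j : tgen [:: i; j] 1 = quadform (\matrix_(l, l') tl ('X_l * 'X_l')) i j.
Proof.
apply: eq_bigr => l _; rewrite mulr_sumr; apply: eq_bigr => l' _.
by rewrite mxE /= mul1r.
Qed.

(** The value of [tl] is symmetric in the letters, so three of them cannot survive against two
    determinants. *)
Lemma ell_tgen3 i1 i2 i3 L p f : (forall a : A, a = - a -> a = 0) ->
  (forall l l', 'X_l * 'X_l' = 'X_l' * 'X_l :> {mpoly C[n]}) ->
  ell (tgen [:: i1, i2, i3 & L] p * f) = 0.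
Proof.
move=> A2 XC; rewrite -[RHS](ell_sym3 A2 i1 i2 i3 (U := fun l1 l2 l3 =>
   tgen L (p * 'X_l1 * 'X_l2 * 'X_l3) * f)); last 2 first.
- by move=> l1 l2 l3; rewrite -[p * _ * _]mulrA XC mulrA.
- by move=> l1 l2 l3; rewrite -2!mulrA XC !mulrA.
rewrite /= mulr_suml linear_sum; apply: eq_bigr => l1 _.
rewrite mulr_sumr mulr_suml linear_sum; apply: eq_bigr => l2 _.
rewrite !mulr_sumr mulr_suml linear_sum; apply: eq_bigr => l3 _.
by rewrite -!mulrA.
Qed.

End GenericTensor.

Section Projector.
Variables (C : numFieldType) (n : nat) (hn : (2 <= n)%N).
Local Notation FF := {mpoly C[ngen n n]}.
Local Notation NN := (n * n + n * n)%N.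
Local Notation R := {mpoly FF[NN]}.

Lemma tlin_is_linear : linear (tlin n : {mpoly C[n]} -> FF).
Proof.
move=> a p p'; rewrite /tlin scaler_sumr -big_split /=; apply: eq_bigr => k _.
by rewrite mcoeffD mcoeffZ scalerDl scalerA.
Qed.

Definition tl : {mpoly C[n]} -> FF := tlin n.
HB.instance Definition _ := GRing.isLinear.Build C {mpoly C[n]} FF *:%R tl tlin_is_linear.

Definition gens (k : 'I_(ngen n n)) : R := tgen tl (letters (gen_mon k)) 1.
(** The action of the generic matrix [z + z'], with values in the polynomials in z and z' over
    [FF]. *)
Definition generic_act : FF -> R := mmap (@mpolyC NN FF \o @mpolyC (ngen n n) C) gens.
HB.instance Definition _ := GRing.RMorphism.copy generic_act
  (mmap (@mpolyC NN FF \o @mpolyC (ngen n n) C) gens).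

Lemma generic_actX k : generic_act 'X_k = gens k.
Proof. by rewrite /generic_act mmapX mmap1U. Qed.

Lemma generic_actZ a f : generic_act (a *: f) = (a%:MP)%:MP * generic_act f.
Proof. by rewrite /generic_act mmapZ. Qed.

(** [quad] is the matrix [T] of the overview and [linv] the column [s]. *)
Definition quad : 'M[FF]_n := \matrix_(l, l') tl ('X_l * 'X_l').
Definition linv : 'cV[FF]_n := \col_l tl 'X_l.

Lemma FF2 (a : FF) : a = - a -> a = 0.
Proof. exact: (@eq_opp_eq0 C). Qed.

Lemma quad_sym : quad^T = quad.
Proof. by apply/matrixP => i j; rewrite !mxE mulrC. Qed.

Lemma J_bordered : J C (leqnn n) = \det (block_mx quad linv linv^T (n%:R)%:M : 'M_(n + 1)).
Proof.
have up i : widen_ord (leqnn n) i = i by apply: val_inj.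
by rewrite /J; congr (\det (block_mx _ _ _ _)); apply/matrixP => i j; rewrite !mxE ?up.
Qed.

Lemma phi_det_quad : phi n (\det quad) = minor C (leqnn n) * minor C (leqnn n).
Proof.
have up i : widen_ord (leqnn n) i = i by apply: val_inj.
pose Y : 'M[{mpoly C[n * n]}]_n := \matrix_(a, j) 'X_(mxvec_index a (widen_ord (leqnn n) j)).
rewrite -det_map_mx (_ : map_mx _ quad = Y^T *m Y); last first.
  apply/matrixP => i j; rewrite !mxE /= /tl.
  have [k _ [-> ->]] := tlin2 C hn i j.
  by apply: eq_bigr => a _; rewrite !mxE !up.
by rewrite det_mulmx det_tr minor_det.
Qed.

(** Its image under [phi] is [D^2], whose pairing with itself is nonzero. *)
Lemma det_quad_neq0 : \det quad != 0.
Proof.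
apply: contraTneq isT => d0.
have := phi_det_quad; rewrite d0 rmorph0 => /esym D0.
have := pairing_minor C (leqnn n); rewrite D0 pairing0l => /esym/eqP.
by rewrite intr_eq0 (gt_eqF (gdet_norm_gt0 n)).
Qed.

Definition adjq : FF := \tr (linv *m linv^T *m \adj quad).

Lemma J_adj : J C (leqnn n) = n%:R * \det quad - adjq :> FF.
Proof. by rewrite J_bordered det_bordered // det_quad_neq0. Qed.

(** A generator of degree at least 3 makes the value zero; otherwise the product consists of linear
    and quadratic factors. *)
Lemma generic_act_monomial (ks : seq 'I_(ngen n n)) :
  in_plane quad linv (ell (\prod_(k <- ks) gens k)).
Proof.
have [/hasP[k kks k3]|/hasPn small] := boolP (has (fun k => 2 < mdeg (gen_mon k))%N ks).
  rewrite (perm_big _ (perm_to_rem kks)) big_cons /gens.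
  case: (letters _) (size_letters (gen_mon k)) k3 => [|i1 [|i2 [|i3 L]]] /= <- // _.
  by rewrite ell_tgen3; [apply: in_plane0 | apply: FF2 | move=> *; apply: mulrC].
have [L [Q ->]] : exists (L : seq 'I_n) (Q : seq ('I_n * 'I_n)), \prod_(k <- ks) gens k
    = \prod_(i <- L) lin linv i * \prod_(t <- Q) quadform quad t.1 t.2.
  elim: ks small => [|k ks IH] small.
    by exists [::], [::]; rewrite !big_nil mulr1.
  have [|L [Q eLQ]] := IH; first by move=> k' hk'; apply: small; rewrite inE hk' orbT.
  have := small k (mem_head _ _); have := gen_mon_bound k; rewrite big_cons eLQ /gens.
  case: (letters _) (size_letters (gen_mon k)) => [|i1 [|i2 [|i3 L']]] <- // _ _.
    by exists (i1 :: L), Q; rewrite big_cons tgen1 mulrA.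
  by exists L, ((i1, i2) :: Q); rewrite big_cons tgen2 mulrCA.
apply: ell_lin_gam => //; [exact: ltnW | exact: quad_sym | exact: det_quad_neq0].
Qed.

(* Cayley's Omega process. *)
Definition omega (f : FF) : FF := ell (generic_act f).

Lemma omegaD f g : omega (f + g) = omega f + omega g.
Proof.
rewrite /omega -[RHS](linearD (pairing _)); congr (ell _).
exact: (rmorphD (mmap _ _)).
Qed.

Lemma omegaZ a f : omega (a *: f) = a *: omega f.
Proof. by rewrite /omega generic_actZ mul_mpolyC ellZ mul_mpolyC. Qed.

Lemma omega_plane f : in_plane quad linv (omega f).
Proof.
rewrite (mpolyE f); apply: (big_ind (fun f => in_plane quad linv (omega f))).
- by rewrite -(scale0r 0) omegaZ scale0r; apply: in_plane0.
- by move=> f1 f2 H1 H2; rewrite omegaD; apply: in_planeD.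
move=> mu _; rewrite omegaZ.
have [c1 [c2 e]] : in_plane quad linv (omega 'X_[mu]).
  have -> : 'X_[mu] = \prod_(k <- letters mu) 'X_k :> FF.
    by rewrite prod_letters -mpolyXE_id.
  rewrite /omega (rmorph_prod (mmap _ _)); have := generic_act_monomial (letters mu).
  by under eq_bigr => k _ do rewrite -generic_actX.
by exists (f@_mu * c1), (f@_mu * c2); rewrite e scalerDr !scalerA.
Qed.

Lemma phi_comb c1 c2 (f g : FF) :
  phi n (c1 *: f + c2 *: g) = c1 *: phi n f + c2 *: phi n g.
Proof. by rewrite /phi comp_mpolyD !comp_mpolyZ. Qed.

Lemma phiM (f g : FF) : phi n (f * g) = phi n f * phi n g.
Proof. exact: (rmorphM (comp_mpoly _)). Qed.

(** Since [phi] kills [J], [adjq] and [n det(T)] have the same image, which is nonzero. An element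
    of the plane in the kernel therefore has [c1 = - n c2]. *)
Lemma omega_ker f : phi n (omega f) = 0 -> exists c : C, omega f = c *: (J C (leqnn n) : FF).
Proof.
have [c1 [c2 ->]] := omega_plane f; rewrite -/adjq => h.
exists (- c2); rewrite J_adj scalerBr !scaleNr opprK; congr (_ + _).
have phiadj : phi n adjq = n%:R *: phi n (\det quad).
  have := J_ker C hn (leqnn n); rewrite J_adj.
  rewrite [phi _ _](rmorphB (comp_mpoly _)) rmorphM rmorph_nat => /eqP.
  by rewrite subr_eq0 => /eqP <-; rewrite mulr_natl scaler_nat.
have e : (c1 + c2 * n%:R) *: phi n (\det quad) = 0.
  by rewrite -[RHS]h phi_comb phiadj scalerA -scalerDl.
move/eqP: e; rewrite scaler_eq0 => /orP[|/eqP p0]; last first.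
  have := pairing_minor C (leqnn n); rewrite -phi_det_quad p0 pairing0l => /esym/eqP.
  by rewrite intr_eq0 (gt_eqF (gdet_norm_gt0 n)).
by rewrite addr_eq0 => /eqP ->; rewrite mulr_natl -scaler_nat scalerA scaleNr.
Qed.

End Projector.

(** * Interpolation: recovering coefficients from values *)

Section Interpolation.
Variables (C : numFieldType).

(** The rows of an inverse Vandermonde matrix express coefficients through values at [d] distinct
    points. *)
Lemma dual_points (d : nat) (p : {poly C}) : p != 0 ->
  exists (s : 'I_d -> C) (c : 'M[C]_d), (forall j, ~~ root p (s j))
    /\ forall e e' : 'I_d, \sum_j c e j * s j ^+ e' = (e == e')%:R.
Proof.
(* [p] has fewer than [size p] roots, so at least [d] of these candidates remain. *)
move=> p0; pose L : seq C := [seq k%:R | k <- iota 0 (d + size p)].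
have uL : uniq L by rewrite map_inj_uniq ?iota_uniq // => i j /eqP; rewrite eqr_nat => /eqP.
pose L' := [seq x <- L | ~~ root p x].
have uL' : uniq L' by rewrite filter_uniq.
have sL' : (d <= size L')%N.
  have := max_poly_roots p0 (filter_all (root p) L) (filter_uniq _ uL).
  have e : (count (root p) L + size L' = d + size p)%N.
    by rewrite size_filter count_predC size_map size_iota.
  rewrite size_filter => /ltnW h.
  by rewrite -(leq_add2r (size p) d) -e [X in (_ <= X)%N]addnC leq_add2r.
pose s (j : 'I_d) := nth 0 L' j.
have ltL (j : 'I_d) : (j < size L')%N by apply: leq_trans sL'.
exists s; pose V := Vandermonde d (\row_j s j).
have uV : V^T \in unitmx.
  rewrite unitmx_tr unitmxE det_Vandermonde unitfE; apply/prodf_neq0 => i _.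
  apply/prodf_neq0 => j ij; rewrite !mxE subr_eq0 nth_uniq ?ltL //.
  by rewrite neq_ltn ij orbT.
exists (invmx V^T); split=> [j|e e'].
  by have := mem_nth 0 (ltL j); rewrite mem_filter => /andP[].
have /matrixP/(_ e e') := mulVmx uV; rewrite !mxE => <-.
by apply: eq_bigr => j _; rewrite !mxE.
Qed.

Variables (A : comAlgType C) (S : A -> Prop).
Hypotheses (S0 : S 0) (SP : forall a u v, S u -> S v -> S (a *: u + v)).

Lemma subspace_sum (I : Type) (r : seq I) (P : pred I) (c : I -> C) (F : I -> A) :
  (forall i, P i -> S (F i)) -> S (\sum_(i <- r | P i) c i *: F i).
Proof. by move=> SF; apply: big_rec => // i x Pi Sx; apply: SP => //; apply: SF. Qed.

(** Each coefficient is a [C]-combination of values at scalar points, and the finitely many roots of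
    [p] can be avoided. *)
Lemma poly_coef_mem (q : {poly A}) (p : {poly C}) : p != 0 ->
  (forall t : C, ~~ root p t -> S q.[t%:A]) -> forall e, S q`_e.
Proof.
move=> p0 Sq e; have [se|es] := leqP (size q) e; first by rewrite nth_default.
have [s [c [sp cs]]] := dual_points (size q) p0.
have -> : q`_e = \sum_j c (Ordinal es) j *: q.[(s j)%:A].
  under eq_bigr => j _ do rewrite horner_coef scaler_sumr.
  rewrite exchange_big (bigD1 (Ordinal es)) //= [X in _ + X]big1 ?addr0 => [|i ni].
    under eq_bigr => j _ do rewrite -in_algE -rmorphXn /= mulr_algr scalerA.
    by rewrite -scaler_suml (cs (Ordinal es) (Ordinal es)) eqxx scale1r.
  under eq_bigr => j _ do rewrite -in_algE -rmorphXn /= mulr_algr scalerA.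
  by rewrite -scaler_suml cs eq_sym (negbTE ni) scale0r.
by apply: subspace_sum => j _; apply: Sq.
Qed.

(** Interpolation on a grid: the functionals of [dual_points] are multiplied over the variables,
    [msize q] bounding every exponent. *)
Lemma mpoly_coef_mem N (q : {mpoly A[N]}) :
  (forall x : 'I_N -> C, S q.@[fun k => (x k)%:A]) -> forall mu, S q@_mu.
Proof.
move=> Sq mu; have [mq|/memN_msupp_eq0 -> //] := boolP (mu \in msupp q).
have lt nu (k : 'I_N) : nu \in msupp q -> (nu k < msize q)%N.
  move=> /msize_mdeg_lt; apply: leq_ltn_trans.
  by rewrite mdegE (bigD1 k) //= leq_addr.
have [s [c [_ cs]]] := dual_points (msize q) (oner_neq0 _).
pose e k := Ordinal (lt mu k mq).
have -> : q@_mu = \sum_(J : {ffun 'I_N -> 'I_(msize q)})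
    (\prod_k c (e k) (J k)) *: q.@[fun k => (s (J k))%:A].
  under eq_bigr => J _ do rewrite mevalE scaler_sumr.
  rewrite exchange_big /=.
  transitivity (\sum_(nu <- msupp q) (nu == mu)%:R *: q@_nu); last first.
    rewrite big_seq [RHS]big_seq; apply: eq_bigr => nu hnu.
    under eq_bigr => J _.
      rewrite (eq_bigr (fun k => in_alg A (s (J k) ^+ nu k))); last first.
        by move=> k _; rewrite rmorphXn.
      rewrite -rmorph_prod /= mulr_algr scalerA -big_split /=.
    over.
    rewrite -scaler_suml; congr (_ *: _).
    rewrite -(bigA_distr_bigA (fun k j => c (e k) j * s j ^+ nu k)) /=.
    have [->|nnu] := eqVneq nu mu.
      by rewrite big1 // => k _; rewrite (cs (e k) (e k)) eqxx.
    have [k nk] : exists k, nu k != mu k.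
      apply/existsP; rewrite -negb_forall; apply: contra nnu => /forallP h.
      by apply/eqP/mnmP => k; apply/eqP/h.
    rewrite (bigD1 k) //= (cs (e k) (Ordinal (lt nu k hnu))) -val_eqE /= eq_sym.
    by rewrite (negbTE nk) mul0r.
  rewrite (bigD1_seq mu) ?msupp_uniq //= eqxx scale1r big1 ?addr0 // => nu /negbTE->.
  by rewrite scale0r.
by apply: subspace_sum => J _; apply: Sq.
Qed.

End Interpolation.

Lemma horner_mmap (A : comNzRingType) N (h : 'I_N -> {poly A}) (f : {mpoly A[N]}) t :
  (mmap polyC h f).[t] = f.@[fun k => (h k).[t]].
Proof.
elim/mpoly_indX: f => [c f g Hf Hg||i f Hf].
- by rewrite mmapD mmapZ hornerD hornerM hornerC Hf Hg mevalD mevalZ.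
- by rewrite -mpolyC1 mmapC mevalC hornerC.
by rewrite !rmorphM /= hornerM Hf mevalXU mmapX mmap1U.
Qed.

Lemma horner_char_poly (R : comNzRingType) n (g : 'M[R]_n) t :
  (char_poly g).[t] = \det (t%:M - g).
Proof.
rewrite /char_poly -horner_evalE -det_map_mx; congr (\det _).
apply/matrixP => i j; rewrite !mxE /= horner_evalE hornerD hornerN !hornerE.
by rewrite hornerMn hornerX.
Qed.

(** * The Omega process on elements semi-invariant modulo an ideal *)

Section Omega.
Variables (C : numFieldType) (n : nat) (hn : (2 <= n)%N).
Local Notation FF := {mpoly C[ngen n n]}.
Local Notation NN := (n * n + n * n)%N.
Local Notation R := {mpoly FF[NN]}.

Definition gmat (x : 'I_NN -> C) : 'M[C]_n :=
  \matrix_(l, i) (x (copy false (mxvec_index l i)) + x (copy true (mxvec_index l i))).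

Lemma meval_tgen x L p : (tgen (@tl C n) L p).@[fun k => (x k)%:A]
  = tl (p * \prod_(i <- L) \sum_l gmat x l i *: 'X_l).
Proof.
elim: L p => [|i L IH] p; first by rewrite big_nil mulr1 mevalC.
rewrite /= big_cons mulrA mulr_sumr mulr_suml !raddf_sum /=; apply: eq_bigr => l _.
rewrite mevalM IH mevalD !mevalXU -scalerDl mulr_algl -linearZ /=; congr (tl _).
by rewrite mxE -scalerAr -scalerAl.
Qed.

Lemma generic_actD (f g : FF) : generic_act (f + g) = generic_act f + generic_act g.
Proof. exact: (rmorphD (mmap _ _)). Qed.

Lemma generic_actM (f g : FF) : generic_act (f * g) = generic_act f * generic_act g.
Proof. exact: (rmorphM (mmap _ _)). Qed.

Lemma generic_act1 : generic_act 1 = 1 :> R.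
Proof. exact: (rmorph1 (mmap _ _)). Qed.

Lemma meval_generic_act (f : FF) x : (generic_act f).@[fun k => (x k)%:A] = actF (gmat x) f.
Proof.
elim/mpoly_indX: f => [c f g Hf Hg||k f Hf].
- have -> : actF (gmat x) (c *: f + g) = c *: actF (gmat x) f + actF (gmat x) g :> FF.
    by rewrite /actF comp_mpolyD comp_mpolyZ.
  rewrite generic_actD generic_actZ mevalD mevalM mevalC -Hf -Hg.
  by rewrite mul_mpolyC.
- transitivity (1 : FF); last by apply/esym; apply: comp_mpoly1.
  rewrite generic_act1.
  by apply: meval1.
have -> : actF (gmat x) ('X_k * f) = actF (gmat x) 'X_k * actF (gmat x) f :> FF.
  exact: (rmorphM (comp_mpoly _)).
rewrite generic_actM mevalM -Hf; congr (_ * _); rewrite /actF.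
rewrite generic_actX comp_mpolyXU -tnth_nth tnth_mktuple meval_tgen mul1r /tl; congr (tlin _ _).
by rewrite /act_poly comp_mpolyX prod_letters; apply: eq_bigr => i _; rewrite tnth_mktuple.
Qed.

Definition detZ : R := gdet FF n \mPo add_vars FF (n * n).

Lemma meval_detZ x : detZ.@[fun k => (x k)%:A] = (\det (gmat x))%:A.
Proof.
rewrite /detZ comp_mpoly_meval.
transitivity (gdet FF n).@[mxvec (map_mx (in_alg FF) (gmat x)) 0]; last first.
  by rewrite meval_gdet det_map_mx.
apply: meval_eq => k; case/mxvec_indexP: k => l i.
by rewrite tnth_mktuple mevalD !mevalXU mxvecE !mxE /= -scalerDl.
Qed.

(** By [pairing_coprod] the two copies merge, and the constant becomes [<D^2, D^2>] for a single
    generic determinant. *)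
Lemma ell_detZ : ell (detZ * detZ) = (gdet_norm n)%:~R :> FF.
Proof.
rewrite -pairing_gdet -pairing_coprod; congr (pairing _ _).
exact/esym/(rmorphM (comp_mpoly _)).
Qed.

Section IdealValued.
Variable S : FF -> Prop.
Hypotheses (S0 : S 0) (SD : forall u v, S u -> S v -> S (u + v)) (SM : forall a u, S u -> S (a * u)).

Let SP (a : C) (u v : FF) : S u -> S v -> S (a *: u + v).
Proof. by move=> Su Sv; apply: SD => //; rewrite -mul_mpolyC; apply: SM. Qed.

(** The coefficients of [h] lie in [S] by interpolation, and [ell] combines them with coefficients
    in [FF]. *)
Lemma ell_mem (h : R) : (forall x : 'I_NN -> C, S h.@[fun k => (x k)%:A]) -> S (ell h).
Proof.
move=> Sh; have Sc := mpoly_coef_mem S0 SP Sh.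
by apply: big_ind => // mu _; rewrite mulrC; apply: SM.
Qed.

Lemma omega_mem (f : FF) : (forall g, S (actF g f)) -> S (omega f).
Proof. by move=> Sf; apply: ell_mem => x; rewrite meval_generic_act. Qed.

(** [ell] is applied to the difference of the generic action on [f] and [det(g)^2 f]. Its values at
    invertible matrices are in [S], and singular ones are reached by interpolation along a line. *)
Lemma omega_semi_invariant (f : FF) :
  (forall g, g \in unitmx -> S (actF g f - \det g ^+ 2 *: f)) ->
  S (omega f - (gdet_norm n)%:~R * f).
Proof.
move=> Sf; pose h : R := generic_act f - f%:MP * (detZ * detZ).
have hE x : h.@[fun k => (x k)%:A] = actF (gmat x) f - \det (gmat x) ^+ 2 *: f.
  rewrite /h mevalB mevalM mevalC mevalM meval_detZ meval_generic_act mulr_algl.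
  by rewrite -scalerAr mulr_algr scalerA expr2.
have -> : omega f - (gdet_norm n)%:~R * f = ell h.
  rewrite /h mul_mpolyC; transitivity (ell (generic_act f) - ell (f *: (detZ * detZ))).
    by rewrite ellZ ell_detZ [f * _]mulrC.
  exact/esym/(linearB (pairing _)).
apply: ell_mem => x.
(* Moving by [t] in the direction [y] adds [t] times the identity to the matrix at [x], which is
   then singular only at the roots of a characteristic polynomial. *)
pose y (k : 'I_NN) : C :=
  match split k with inl k0 => mxvec (1%:M : 'M[C]_n) 0 k0 | inr _ => 0 end.
have gy (t : C) : gmat (fun k => x k + t * y k) = t%:M - (- gmat x).
  apply/matrixP => l i; rewrite !mxE /y /copy.
  have := unsplitK (inl (mxvec_index l i) : 'I_(n * n) + 'I_(n * n)).
  have := unsplitK (inr (mxvec_index l i) : 'I_(n * n) + 'I_(n * n)).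
  move=> /= -> ->; rewrite mxvecE mxE mulr0 addr0 opprK mulr_natr.
  by rewrite addrAC addrC.
(* The restriction of [h] to this line; its constant coefficient is the value at [x]. *)
pose q := mmap polyC (fun k => (x k)%:A%:P + (y k)%:A *: 'X) h.
have qE t : q.[t%:A] = h.@[fun k => (x k + t * y k)%:A].
  rewrite horner_mmap; apply: meval_eq => k.
  by rewrite hornerD hornerC hornerZ hornerX mulr_algl scalerA mulrC -scalerDl.
have -> : h.@[fun k => (x k)%:A] = q`_0.
  rewrite -horner_coef0 -[X in q.[X]](scale0r 1) qE; apply: meval_eq => k.
  by rewrite mul0r addr0.
apply: (poly_coef_mem S0 SP (p := char_poly (- gmat x))).
  by rewrite monic_neq0 ?char_poly_monic.
move=> t; rewrite rootE horner_char_poly qE hE gy => nz.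
by apply: Sf; rewrite unitmxE unitfE.
Qed.

End IdealValued.

(* Averaging over GL_n, in the form of the Omega process, turns an element of
   the kernel that is semi-invariant modulo F+ ker(phi) into a multiple of J. *)
Lemma semi_invariant_J (f : FF) : ker_phi n f ->
  (forall g, g \in unitmx -> Fplus_ker n (actF g f - \det g ^+ 2 *: f)) ->
  exists c : C, Fplus_ker n (f - c *: (J C (leqnn n) : FF)).
Proof.
move=> kf Sf.
(* The kernel is an ideal stable under every matrix, so the Omega process preserves it. *)
have ko : phi n (omega f) = 0.
  apply: (omega_mem (S := fun u => phi n u = 0)).
  - exact: rmorph0.
  - by move=> u v u0 v0; rewrite -[u]scale1r -[v]scale1r phi_comb u0 v0 !scaler0 addr0.
  - by move=> a u u0; rewrite phiM u0 mulr0.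
  by move=> g; apply: actF_ker.
have [c oc] := omega_ker hn ko.
have k0 : (gdet_norm n)%:~R != 0 :> C by rewrite intr_eq0 (gt_eqF (gdet_norm_gt0 n)).
exists ((gdet_norm n)%:~R^-1 * c).
have Sm (a u : FF) : Fplus_ker n u -> Fplus_ker n (a * u).
  case=> s hs ->; exists [seq (ab.1, a * ab.2) | ab <- s].
    move=> _ /mapP[ab /hs[h1 h2] ->]; split=> //=.
    by rewrite /ker_phi phiM h2 mulr0.
  by rewrite big_map mulr_sumr; apply: eq_bigr => ab _; rewrite /= mulrCA.
have := omega_semi_invariant (@Fplus_ker0 C n n n) (@Fplus_kerD C n n n) Sm Sf.
rewrite oc => /(Fplus_ker_scale (- (gdet_norm n)%:~R^-1)).
rewrite scalerBr scaleNr scalerA -[_ * f]/(_ * f : FF) mulrzl -scaler_int scaleNr scalerA.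
by rewrite mulVf // scale1r opprK addrC.
Qed.

End Omega.

(** * Highest weight vectors of weight 2^n *)

Lemma poly_zero_off0 (C : numFieldType) (p : {poly C}) :
  (forall s, s != 0 -> p.[s] = 0) -> p = 0.
Proof.
move=> p0; apply/eqP; apply: contraT => np.
have := @max_poly_roots _ p [seq k.+1%:R | k <- iota 0 (size p)] np.
rewrite size_map size_iota ltnn => -> //.
  by apply/allP => _ /mapP[k _ ->]; rewrite rootE p0 // pnatr_eq0.
by rewrite map_inj_uniq ?iota_uniq // => i j /eqP; rewrite eqr_nat => /eqP[].
Qed.

Lemma poly_inv_const (C : numFieldType) (p q : {poly C}) :
  (forall s, s != 0 -> p.[s] = q.[s^-1]) -> forall s, p.[s] = p.[0].
Proof.
move=> pq; suff: (size p <= 1)%N by move/size1_polyC => -> s; rewrite !hornerC.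
(* [r] is s^N q(1/s), of degree at most [N], so ['X^N * p = r] forces [p] to be constant. *)
pose N := size q; pose r := \poly_(e < N.+1) q`_(N - e).
have e : 'X^N * p = r.
  apply/eqP; rewrite -subr_eq0; apply/eqP/poly_zero_off0 => s s0.
  rewrite hornerD hornerN hornerM hornerXn pq // /r horner_poly horner_coef mulr_sumr.
  rewrite [X in _ - X](reindex_inj rev_ord_inj) big_ord_recr /=.
  rewrite subnn subn0 [q`_N]nth_default // mul0r addr0.
  apply/eqP; rewrite subr_eq0; apply/eqP; apply: eq_bigr => i _.
  rewrite subSS subKn ?(ltnW (ltn_ord i)) // exprVn mulrCA; congr (_ * _).
  by rewrite expfB.
have [->|np] := eqVneq p 0; first by rewrite size_poly0.
have : (size ('X^N * p)%R <= N.+1)%N by rewrite e size_poly.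
by rewrite size_monicM ?monicXn // size_polyXn addSn /= -[N.+1]addn1 leq_add2l.
Qed.

Section Transvections.
Variables (C : numFieldType) (n : nat).

Definition transv (i j : 'I_n) (s : C) : 'M[C]_n := 1%:M + s *: delta_mx i j.

Lemma transvE i j s p r : transv i j s p r = (p == r)%:R + s * ((p == i) && (r == j))%:R.
Proof. by rewrite !mxE. Qed.

Lemma mul_transv i j s (M : 'M[C]_n) p r :
  (transv i j s *m M) p r = M p r + (p == i)%:R * s * M j r.
Proof.
rewrite mulmxDl mul1mx -scalemxAl !mxE (bigD1 j) //= big1 ?addr0 => [|k nk].
  by rewrite mxE eqxx andbT mulrA [s * _]mulrC.
by rewrite mxE (negbTE nk) andbF mul0r.
Qed.

Lemma mul_mx_transv i j s (M : 'M[C]_n) p r :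
  (M *m transv i j s) p r = M p r + M p i * s * (r == j)%:R.
Proof.
rewrite mulmxDr mulmx1 -scalemxAr !mxE (bigD1 i) //= big1 ?addr0 => [|k nk].
  by rewrite mxE eqxx /= mulrCA mulrA.
by rewrite mxE (negbTE nk) mulr0.
Qed.

(** For distinct [i], [j] and nonzero [s] this is the SL_2 element with entries [- s^-1] at [(i, j)]
    and [s] at [(j, i)]; the factorisation trades a lower transvection in [s] for upper ones in
    [s^-1]. *)
Definition weyl i j s := transv i j (- s^-1) *m transv j i s *m transv i j (- s^-1).

Lemma weylE i j s p r : i != j -> s != 0 -> weyl i j s p r =
  if p == i then - s^-1 * (r == j)%:R else if p == j then s * (r == i)%:R else (p == r)%:R.
Proof.
move=> nij s0; have nji : j != i by rewrite eq_sym.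
rewrite mul_mx_transv !mul_transv !transvE ?eqxx ?(negbTE nij) ?(negbTE nji).
rewrite [j == r]eq_sym; have [->|npi] := eqVneq p i.
  rewrite ?eqxx ?(negbTE nij) ?(negbTE nji) [i == r]eq_sym.
  case: (r == i) (r == j) => -[] /=; by field.
have [->|npj] := eqVneq p j.
  rewrite ?eqxx ?(negbTE nij) ?(negbTE nji) [j == r]eq_sym.
  case: (r == i) (r == j) => -[] /=; by field.
by rewrite /= ?andbF; field.
Qed.

Definition diag_pair (i j : 'I_n) (a b : C) : 'rV[C]_n :=
  \row_k (if k == i then a else if k == j then b else 1).

Lemma prod_diag_pair i j a b : i != j -> \prod_k diag_pair i j a b 0 k = a * b.
Proof.
move=> nij; rewrite (bigD1 i) //= (bigD1 j) /=; last by rewrite eq_sym.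
rewrite !mxE !eqxx eq_sym (negbTE nij) big1 ?mulr1 // => k /andP[ki kj].
by rewrite mxE (negbTE ki) (negbTE kj).
Qed.

Lemma mul_diag_mxE (M : 'M[C]_n) d p r : (M *m diag_mx d) p r = M p r * d 0 r.
Proof. by rewrite mul_mx_diag mxE. Qed.

Lemma upper_transv (i j : 'I_n) s : (i < j)%N -> upper_unitriangular (transv i j s).
Proof.
move=> ij; split=> [p r rp|p]; rewrite transvE.
  have -> : p == r = false by apply: contraTF rp => /eqP->; rewrite ltnn.
  have [pi|_] := eqVneq p i; last by rewrite mulr0 addr0.
  have [rj|_] := eqVneq r j; last by rewrite mulr0 addr0.
  by move: rp; rewrite pi rj ltnNge (ltnW ij).
rewrite eqxx; have [pi|_] := eqVneq p i; last by rewrite mulr0 addr0.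
rewrite pi; have [ej|_] := eqVneq i j; last by rewrite mulr0 addr0.
by move: ij; rewrite ej ltnn.
Qed.

Lemma transvD (i j : 'I_n) a b : i != j -> transv i j a *m transv i j b = transv i j (a + b).
Proof.
move=> nij; apply/matrixP => p r; rewrite mul_transv !transvE.
rewrite [j == i]eq_sym (negbTE nij) [j == r]eq_sym /=.
by case: (p == i) (r == j) => -[] /=; ring.
Qed.

Lemma transv0 (i j : 'I_n) : transv i j 0 = 1%:M.
Proof. by rewrite /transv scale0r addr0. Qed.

Lemma weyl_diag (i j : 'I_n) (s : C) : i != j -> s != 0 ->
  weyl i j s = weyl i j 1 *m diag_mx (diag_pair i j s s^-1).
Proof.
move=> nij s0; have nji : j != i by rewrite eq_sym.
apply/matrixP => p r; rewrite mul_diag_mxE !weylE ?oner_neq0 // mxE.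
have [pi|npi] := eqVneq p i; rewrite ?pi.
  have [rj|nrj] := eqVneq r j; rewrite ?rj; last by rewrite !mulr0 mul0r.
  by rewrite (negbTE nji); field.
have [pj|npj] := eqVneq p j; rewrite ?pj.
  have [ri|nri] := eqVneq r i; rewrite ?ri; last by rewrite !mulr0 mul0r.
  by field.
have [pr|_] := eqVneq p r; rewrite -?pr; last by rewrite mul0r.
by rewrite (negbTE npi) (negbTE npj) mulr1.
Qed.

Lemma tperm_weyl (i j : 'I_n) : i != j ->
  tperm_mx i j = weyl i j 1 *m diag_mx (diag_pair i j 1 (-1)).
Proof.
move=> nij; have nji : j != i by rewrite eq_sym.
apply/matrixP => p r; rewrite mul_diag_mxE weylE ?oner_neq0 // !mxE.
have [pi|npi] := eqVneq p i; rewrite ?pi.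
  rewrite tpermL [j == r]eq_sym; have [rj|nrj] := eqVneq r j; rewrite ?rj; last by rewrite mulr0 mul0r.
  by rewrite (negbTE nji) invr1; ring.
have [pj|npj] := eqVneq p j; rewrite ?pj.
  rewrite tpermR [i == r]eq_sym; have [ri|nri] := eqVneq r i; rewrite ?ri; last by rewrite mulr0 mul0r.
  by rewrite !mulr1.
rewrite tpermD 1?eq_sym // [r == p]eq_sym.
have [pr|_] := eqVneq p r; rewrite -?pr; last by rewrite mul0r.
by rewrite (negbTE npi) (negbTE npj) mulr1.
Qed.

End Transvections.

(** * From highest weight vectors to semi-invariants *)

Section SemiInvariant.
Variables (C : numFieldType) (n : nat) (V : lmodType C) (act : 'M[C]_n -> V -> V).
Hypotheses (actP : forall g a u v, act g (a *: u + v) = a *: act g u + act g v)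
  (actM : forall g h v, act (g *m h) v = act g (act h v)) (act1 : forall v, act 1%:M v = v).
Variables (W : V -> Prop) (v : V).
Hypotheses (subW : submodule act W) (polyW : polynomial_rep act W) (Wv : W v).
Hypothesis hwv : highest_weight_vector act (nseq n 2%N) v.

Lemma act0 g : act g 0 = 0.
Proof. by have := actP g (-1) 0 0; rewrite scaler0 addr0 scaleN1r addNr. Qed.

Lemma actZ g a u : act g (a *: u) = a *: act g u.
Proof. by rewrite -[a *: u]addr0 actP act0 addr0. Qed.

Lemma act_sum g k (c : 'I_k -> C) (e : 'I_k -> V) :
  act g (\sum_a c a *: e a) = \sum_a c a *: act g (e a).
Proof.
apply: (big_ind2 (fun x y => act g x = y)) => [|x1 x2 y1 y2 e1 e2|a _].
- exact: act0.
- by rewrite -[x1]scale1r actP scale1r e1 e2.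
exact: actZ.
Qed.

Definition semi g := g \in unitmx /\ act g v = \det g ^+ 2 *: v.

Lemma semiM g h : semi g -> semi h -> semi (g *m h).
Proof.
move=> [ug eg] [uh eh]; split; first by rewrite unitmx_mul ug.
by rewrite actM eh actZ eg scalerA det_mulmx exprMn mulrC.
Qed.

Lemma semi_diag d : diag_mx d \in unitmx -> semi (diag_mx d).
Proof.
move=> ud; split=> //; case: hwv => _ /(_ d ud) -> _; congr (_ *: _).
rewrite det_diag -prodrXl; apply: eq_bigr => i _.
by rewrite nth_nseq ltn_ord.
Qed.

Lemma det_unitriangular (g : 'M[C]_n) : upper_unitriangular g -> \det g = 1.
Proof.
case=> g0 g1; rewrite -det_tr det_trig; first by rewrite big1 // => i _; rewrite mxE.
by apply/is_trig_mxP => i j ij; rewrite mxE g0.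
Qed.

Lemma semi_upper g : upper_unitriangular g -> semi g.
Proof.
move=> ug; case: hwv => _ _ /(_ g ug) e; split; last by rewrite det_unitriangular // expr1n scale1r.
by rewrite unitmxE det_unitriangular // unitr1.
Qed.

(* Matrix coefficients of a one-parameter family g + s h are polynomials in s. *)
Lemma poly_orbit : exists (k : nat) (e : 'I_k -> V), is_basis e W /\
  forall u (g h : 'M[C]_n), W u -> (forall s, g + s *: h \in unitmx) ->
  exists p : 'I_k -> {poly C}, forall s, act (g + s *: h) u = \sum_b (p b).[s] *: e b.
Proof.
case: polyW => k [e [P [be Pe]]]; exists k, e; split=> // u g h Wu ugh.
have [c [-> _]] := be.2 u Wu.
pose q a b := mmap polyC (fun l => (mxvec g 0 l)%:P + (mxvec h 0 l) *: 'X) (P a b).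
exists (fun b => \sum_a c 0 a *: q a b) => s.
rewrite act_sum.
under eq_bigr => a _ do rewrite Pe // scaler_sumr.
rewrite exchange_big; apply: eq_bigr => b _.
rewrite horner_sum scaler_suml; apply: eq_bigr => a _.
rewrite hornerZ horner_mmap scalerA; congr (_ * _ *: _).
apply: meval_eq => l; rewrite hornerD hornerC hornerZ hornerX.
by rewrite linearD linearZ /= !mxE mulrC.
Qed.

(* The image of the highest weight vector under a lower transvection is a
   polynomial in s, and by SL_2 also one in 1/s, hence it is constant. *)
Lemma weyl_fix (i j : 'I_n) : (i < j)%N -> act (weyl i j 1) v = v.
Proof.
move=> ij; have nij : i != j by apply: contraTneq ij => ->; rewrite ltnn.
have nji : j != i by rewrite eq_sym.
have up s : act (transv i j s) v = v by case: hwv => _ _; apply; apply: upper_transv.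
have utr (a b : 'I_n) (s : C) : a != b -> transv a b s \in unitmx.
  move=> nab; have := mulmx1_unit (A := transv a b s) (B := transv a b (- s)).
  by rewrite transvD // subrr transv0 => /(_ erefl)[].
set u := act (weyl i j 1) v.
have uE s : s != 0 -> act (transv j i s) v = act (transv i j s^-1) u.
  (* The torus element diag(s, 1/s) has determinant 1 and fixes [v], so every [weyl i j s] sends [v]
     to the same [u]. *)
  move=> s0; have {1}-> : u = act (weyl i j s) v.
    rewrite weyl_diag // actM; congr (act _ _).
    have ud : diag_mx (diag_pair i j s s^-1) \in unitmx.
      by rewrite unitmxE det_diag prod_diag_pair // divff // unitr1.
    have [_ ->] := semi_diag ud.
    by rewrite det_diag prod_diag_pair // divff // expr1n scale1r.
  by rewrite /weyl !actM up -actM transvD // subrr transv0 act1.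
have Wu : W u.
  rewrite /u /weyl !actM; do 3 (apply: subW.2; [exact: utr | ]); exact: Wv.
have [k [e [be po]]] := poly_orbit.
have [p pE] := po v 1%:M (delta_mx j i) Wv (fun s => utr j i s nji).
have [q qE] := po u 1%:M (delta_mx i j) Wu (fun s => utr i j s nij).
(* Coordinates in a basis are unique, so the two expansions agree coefficient by coefficient. *)
have pq b s : s != 0 -> (p b).[s] = (q b).[s^-1].
  move=> s0; have := uE s s0; rewrite pE qE => e1.
  have Wx : W (\sum_b0 (p b0).[s] *: e b0) by rewrite -pE; apply: subW.2 => //; apply: utr.
  have [c [_ uniq]] := be.2 _ Wx.
  have /rowP/(_ b) : \row_b (p b).[s] = \row_b (q b).[s^-1].
    transitivity c; [symmetry|]; apply: uniq.
      by apply: eq_bigr => b0 _; rewrite mxE.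
    by rewrite e1; apply: eq_bigr => b0 _; rewrite mxE.
  by rewrite !mxE.
(* The orbit is constant in [s], and at [s = 0] it is [v]. *)
have f1 : act (transv j i 1) v = v.
  rewrite /transv pE -[RHS]act1 -(transv0 C j i) /transv pE.
  by apply: eq_bigr => b _; congr (_ *: _); apply: (poly_inv_const (pq b)).
have := uE 1 (oner_neq0 _); rewrite f1 invr1 => e1.
rewrite -(up (-1)) e1 -actM transvD // addNr transv0 act1 //.
Qed.

Lemma semi_tperm (i j : 'I_n) : i != j -> semi (tperm_mx i j).
Proof.
wlog ij : i j / (i < j)%N => [H nij|nij].
  have := nij; rewrite neq_ltn => /orP[|] ij; first exact: H.
  by rewrite /tperm_mx tpermC; apply: H => //; rewrite eq_sym.
rewrite tperm_weyl //; apply: semiM; last first.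
  by apply: semi_diag; rewrite unitmxE det_diag prod_diag_pair // mul1r unitrN unitr1.
have dw : \det (weyl i j 1) = 1 :> C.
  have := congr1 determinant (tperm_weyl C nij).
  rewrite det_perm odd_tperm nij det_mulmx det_diag prod_diag_pair // mul1r expr1 mulrN1.
  by move/oppr_inj <-.
split; first by rewrite unitmxE dw unitr1.
by rewrite weyl_fix // dw expr1n scale1r.
Qed.

Lemma semi1 : semi 1%:M.
Proof. by split; rewrite ?unitmx1 // act1 det1 expr1n scale1r. Qed.

Lemma semi_perm (s : 'S_n) : semi (perm_mx s).
Proof.
case: (prod_tpermP s) => ts -> {s}; elim: ts => [|[i j] ts IH] /=.
  by rewrite big_nil perm_mx1 => _; apply: semi1.
by case/andP=> nij dts; rewrite big_cons perm_mxM; apply: semiM; [apply: semi_tperm | apply: IH].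
Qed.

(** Conjugation by the permutation reversing the coordinates makes [g] upper unitriangular. *)
Lemma semi_lower (g : 'M[C]_n) : (forall i j : 'I_n, (i <= j)%N -> g i j = (i == j)%:R) -> semi g.
Proof.
move=> lg; pose w := perm_mx (perm (@rev_ord_inj n)) : 'M[C]_n.
have -> : g = w *m (w *m g *m w) *m w.
  have ww : w *m w = 1%:M.
    rewrite -perm_mxM -perm_mx1; congr perm_mx; apply/permP => k.
    by rewrite permM !permE rev_ordK.
  by rewrite !mulmxA ww mul1mx -mulmxA ww mulmx1.
apply: semiM; last exact: semi_perm.
apply: semiM; first exact: semi_perm.
have E p r : (w *m g *m w) p r = g (rev_ord p) (rev_ord r).
  have -> : w *m g *m w = col_perm (perm (@rev_ord_inj n))^-1 (row_perm (perm (@rev_ord_inj n)) g).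
    by rewrite col_permE row_permE invgK.
  rewrite !mxE permE; congr (g _ _); apply: (canLR (permK _)).
  by rewrite permE rev_ordK.
apply: semi_upper; split=> [p r rp|p]; rewrite E lg ?eqxx //.
  by rewrite (inj_eq rev_ord_inj); case: eqP rp => // ->; rewrite ltnn.
by rewrite leq_sub2l // ltnS ltnW.
Qed.

End SemiInvariant.

Section SemiInvariantAll.
Variables (C : numFieldType) (n : nat) (V : lmodType C) (act : 'M[C]_n -> V -> V).
Hypotheses (actP : forall g a u v, act g (a *: u + v) = a *: act g u + act g v)
  (actM : forall g h v, act (g *m h) v = act g (act h v)) (act1 : forall v, act 1%:M v = v).
Variables (W : V -> Prop) (v : V).
Hypotheses (subW : submodule act W) (polyW : polynomial_rep act W) (Wv : W v).
Hypothesis hwv : highest_weight_vector act (nseq n 2%N) v.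

(** The LUP decomposition writes [g] as a product of a permutation, a lower unitriangular, a
    diagonal and an upper unitriangular matrix, for each of which the claim is known. *)
Lemma highest_weight_semi (g : 'M[C]_n) : g \in unitmx -> act g v = \det g ^+ 2 *: v.
Proof.
move=> ug; suff: semi act v g by case.
(* Size 0 is settled first; the decomposition below needs a positive size. *)
case: n act actP actM act1 polyW subW hwv g ug => [|n'] act' aP aM a1 pW sW hw g ug.
  rewrite (_ : g = 1%:M); first exact: semi1.
  by apply/matrixP => -[].
have := cormen_lup_correct g; have := cormen_lup_perm g.
have := @cormen_lup_lower _ _ g; have := @cormen_lup_upper _ _ g.
have := cormen_lup_detL g.
case: (cormen_lup g) => [[P L] U] /= dL hU hL /is_perm_mxP[s Ps] e.
have -> : g = perm_mx s^-1 *m (L *m U).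
  by rewrite mulmxE -e Ps -mulmxE mulmxA -perm_mxM mulVg perm_mx1 mul1mx.
have uU : U \in unitmx.
  have := congr1 determinant e; rewrite -!mulmxE !det_mulmx dL mul1r => dU.
  by rewrite unitmxE -dU -det_mulmx -unitmxE unitmx_mul Ps unitmx_perm.
have [dU uii] : \det U = \prod_i U i i /\ forall i, U i i != 0.
  have dU : \det U = \prod_i U i i.
    rewrite -det_tr det_trig; first by apply: eq_bigr => i _; rewrite mxE.
    by apply/is_trig_mxP => i j ij; rewrite mxE hU.
  split=> // i; move: uU; rewrite unitmxE unitfE dU; apply: contraNneq => u0.
  by rewrite (bigD1 i) //= u0 mul0r.
(* Dividing the rows of [U] by its diagonal entries splits off the torus part. *)
pose d := \row_i U i i : 'rV[C]_n'.+1.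
pose U' := \matrix_(i, j) ((U i i)^-1 * U i j) : 'M[C]_n'.+1.
have -> : U = diag_mx d *m U'.
  by apply/matrixP => i j; rewrite mul_diag_mx !mxE mulrA divff ?mul1r.
have ud : diag_mx d \in unitmx.
  by rewrite unitmxE unitfE det_diag; apply/prodf_neq0 => i _; rewrite mxE.
apply: semiM => //; first exact: (semi_perm aP aM a1 sW pW Wv hw).
apply: semiM => //; first exact: (semi_lower aP aM a1 sW pW Wv hw).
apply: semiM => //; first exact: semi_diag.
apply: semi_upper => //; split=> [i j ij|i]; rewrite mxE.
  by rewrite (hU _ _ ij) mulr0.
by rewrite mulVf.
Qed.

End SemiInvariantAll.

(** * The multiplicity *)

Section Action.
Variables (C : numFieldType) (m d : nat).
Local Notation FF := {mpoly C[ngen m d]}.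

Lemma act_polyM (g h : 'M[C]_m) p : act_poly (g *m h) p = act_poly g (act_poly h p).
Proof.
rewrite /act_poly comp_mpolyA; congr (_ \mPo _); apply: eq_from_tnth => i.
rewrite !tnth_mktuple raddf_sum /=.
under [RHS]eq_bigr => l _ do
  rewrite comp_mpolyZ comp_mpolyXU -tnth_nth tnth_mktuple scaler_sumr.
rewrite exchange_big; apply: eq_bigr => k _ /=.
rewrite mxE scaler_suml; apply: eq_bigr => l _.
by rewrite scalerA mulrC.
Qed.

Lemma act_poly1 p : act_poly (1%:M : 'M[C]_m) p = p.
Proof.
rewrite -[RHS]comp_mpoly_id; congr (_ \mPo _); apply: eq_from_tnth => i.
rewrite !tnth_mktuple (bigD1 i) //= mxE eqxx scale1r big1 ?addr0 // => l nl.
by rewrite mxE (negbTE nl) scale0r.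
Qed.

Lemma homog_gens (p : {mpoly C[m]}) e : (0 < e <= d)%N -> p \is ishomog1 e mdeg ->
  p = \sum_(k < ngen m d) p@_(gen_mon k) *: 'X_[gen_mon k].
Proof.
move=> he hp; rewrite {1}[p]mpolyE.
rewrite [RHS](bigID (fun k => gen_mon k \in msupp p)) /= [X in _ = _ + X]big1 ?addr0; last first.
  by move=> k /memN_msupp_eq0 ->; rewrite scale0r.
rewrite -[RHS]big_filter -(big_map (@gen_mon m d) xpredT (fun w => p@_w *: 'X_[w])) /=.
apply: perm_big; apply: uniq_perm => //.
  by rewrite map_inj_uniq ?filter_uniq ?index_enum_uniq //; apply: gen_mon_inj.
move=> w; apply/idP/mapP => [hw|[k]]; last by rewrite mem_filter => /andP[h _] ->.
have [|k kw] := @gen_monP m d w; first by rewrite (dhomog_mf hp hw).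
by exists k; rewrite // mem_filter kw hw mem_index_enum.
Qed.

Lemma tlin_sum (I : Type) (r : seq I) (c : I -> C) (F : I -> {mpoly C[m]}) :
  tlin d (\sum_(i <- r) c i *: F i) = \sum_(i <- r) c i *: (tlin d (F i) : FF) :> FF.
Proof.
rewrite /tlin; under [RHS]eq_bigr => i _ do rewrite scaler_sumr.
rewrite exchange_big; apply: eq_bigr => k _ /=.
rewrite raddf_sum scaler_suml; apply: eq_bigr => i _.
by rewrite /= mcoeffZ scalerA.
Qed.

Lemma actF_X g k : actF g ('X_k : FF) = tlin d (act_poly g 'X_[gen_mon k]) :> FF.
Proof. by rewrite /actF comp_mpolyXU -tnth_nth tnth_mktuple. Qed.

(** [tlin] discards the monomials outside degrees 1 to [d]; homogeneity ensures that none of [p] is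
    lost, so the claim reduces to the generators. *)
Lemma actF_tlin g (p : {mpoly C[m]}) e : (0 < e <= d)%N -> p \is ishomog1 e mdeg ->
  actF g (tlin d p) = tlin d (act_poly g p) :> FF.
Proof.
move=> he hp; rewrite [in RHS](homog_gens he hp) /act_poly raddf_sum /=.
transitivity (\sum_(k < ngen m d) p@_(gen_mon k) *:
    (tlin d (act_poly g 'X_[gen_mon k]) : FF)).
  rewrite /actF /tlin raddf_sum /=; apply: eq_bigr => k _.
  by rewrite comp_mpolyZ; congr (_ *: _); apply: actF_X.
rewrite -tlin_sum; congr (tlin _ _); apply: eq_bigr => k _.
by rewrite comp_mpolyZ.
Qed.

Lemma actFM g h (f : FF) : actF (g *m h) f = actF g (actF h f) :> FF.
Proof.
rewrite /actF comp_mpolyA; congr (_ \mPo _); apply: eq_from_tnth => k.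
rewrite !tnth_mktuple act_polyM; apply/esym/actF_tlin; last exact: act_poly_homog.
exact: gen_mon_bound.
Qed.

Lemma actF1 (f : FF) : actF 1%:M f = f :> FF.
Proof.
rewrite -[RHS]comp_mpoly_id; congr (_ \mPo _); apply: eq_from_tnth => k.
by rewrite !tnth_mktuple act_poly1 tlinX.
Qed.

Lemma actF_linear g a (f h : FF) : actF g (a *: f + h) = a *: actF g f + actF g h :> FF.
Proof. by rewrite /actF comp_mpolyD comp_mpolyZ. Qed.

End Action.

Section Quotient.
Variables (C : numFieldType) (n m d : nat).
Local Notation FF := {mpoly C[ngen m d]}.
Local Notation Q := (FmodK C n m d).
Local Notation pi := (@piK C n m d).

Lemma piK_surj (x : Q) : exists f : FF, x = pi f.
Proof. by exists (reprFmodK x); rewrite /piK modquot_reprK. Qed.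

Lemma piK0 : pi 0 = 0.
Proof. by have := @piK_is_linear C n m d (-1) 0 0; rewrite scaler0 addr0 scaleN1r addNr. Qed.

Lemma piKZ a (f : FF) : pi (a *: f) = a *: pi f.
Proof. by rewrite -[a *: f]addr0 piK_is_linear piK0 addr0. Qed.

Lemma actKP g a (u v : Q) : actK g (a *: u + v) = a *: actK g u + actK g v.
Proof.
have [f ->] := piK_surj u; have [h ->] := piK_surj v.
by rewrite -piK_is_linear !actK_pi actF_linear piK_is_linear.
Qed.

Lemma actKM g h (u : Q) : actK (g *m h) u = actK g (actK h u).
Proof. by have [f ->] := piK_surj u; rewrite !actK_pi actFM. Qed.

Lemma actK1 (u : Q) : actK 1%:M u = u.
Proof. by have [f ->] := piK_surj u; rewrite actK_pi actF1. Qed.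

Lemma actKZ g a (u : Q) : actK g (a *: u) = a *: actK g u.
Proof.
have [f ->] := piK_surj u; rewrite -piKZ !actK_pi -piKZ; congr (pi _).
by rewrite /actF comp_mpolyZ.
Qed.

End Quotient.

(** * The line spanned by [J] in the quotient *)

Section Multiplicity.
Variables (C : numFieldType) (n : nat) (hn : (2 <= n)%N).
Local Notation FF := {mpoly C[ngen n n]}.
Local Notation Jn := (J C (leqnn n) : FF).
Local Notation Q := (FmodK C n n n).
Local Notation pi := (@piK C n n n).

(** A linear change of variables acts on the bordered matrix by congruence with the block matrix
    diag(g, 1). *)
Lemma actF_J (g : 'M[C]_n) : actF g Jn = \det g ^+ 2 *: Jn.
Proof.
pose G : 'M[FF]_n := map_mx (@mpolyC _ C) g.
have hX (i : 'I_n) : ('X_i : {mpoly C[n]}) \is ishomog1 1 mdeg.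
  by rewrite dhomogX /= mdeg1.
have gX (i : 'I_n) : act_poly g 'X_i = \sum_l g l i *: 'X_l.
  by rewrite /act_poly comp_mpolyXU -tnth_nth tnth_mktuple.
have actT : map_mx (actF g : FF -> FF) (quad C n) = G^T *m quad C n *m G.
  apply/matrixP => i j; rewrite mxE [quad C n i j]mxE /tl.
  rewrite (@actF_tlin _ _ _ _ _ 2) //; last by apply: (dhomogM (hX i) (hX j)).
  rewrite /act_poly rmorphM /= -/(act_poly g 'X_i) -/(act_poly g 'X_j) !gX.
  have -> : (\sum_l g l i *: 'X_l) * (\sum_l g l j *: 'X_l)
      = \sum_l g l i *: \sum_l' g l' j *: ('X_l * 'X_l') :> {mpoly C[n]}.
    rewrite mulr_suml; apply: eq_bigr => l _; rewrite mulr_sumr scaler_sumr.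
    by apply: eq_bigr => l' _; rewrite -scalerAl -scalerAr.
  rewrite tlin_sum [RHS]mxE; under [RHS]eq_bigr => l' _ do rewrite mxE mulr_suml.
  rewrite exchange_big; apply: eq_bigr => l _ /=.
  rewrite tlin_sum scaler_sumr; apply: eq_bigr => l' _.
  by rewrite !mxE /tl mul_mpolyC [RHS]mulrC mul_mpolyC !scalerA mulrC.
have actL : map_mx (actF g : FF -> FF) (linv C n) = G^T *m linv C n.
  apply/matrixP => i j; rewrite mxE [linv C n i j]mxE /tl.
  rewrite (@actF_tlin _ _ _ _ _ 1) ?(ltnW hn) // gX tlin_sum mxE.
  by apply: eq_bigr => l _; rewrite !mxE mul_mpolyC.
rewrite J_bordered -[LHS]/(comp_mpoly _ _) -det_map_mx map_block_mx.
pose M : 'M[FF]_(n + 1) := block_mx (quad C n) (linv C n) (linv C n)^T (n%:R)%:M.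
pose H : 'M[FF]_(n + 1) := block_mx G 0 0 1%:M.
rewrite [X in \det X](_ : _ = H^T *m M *m H).
  rewrite !det_mulmx det_tr det_ublock det1 mulr1 det_map_mx -/M.
  by rewrite [LHS]mulrC mulrA -mpolyCM -expr2 mul_mpolyC.
rewrite /H tr_block_mx !mulmx_block !trmx0 !trmx1 !(mulmx0, mul0mx, mul1mx, mulmx1, addr0, add0r).
congr block_mx.
- exact: actT.
- exact: actL.
- by rewrite -[_ *m G]trmxK trmx_mul trmxK -actL map_trmx.
by apply/matrixP => i j; rewrite !mxE rmorphMn /= rmorph_nat.
Qed.

Lemma actK_J g : actK g (pi Jn) = \det g ^+ 2 *: pi Jn.
Proof. by rewrite actK_pi actF_J piKZ. Qed.

Lemma piJ_neq0 : pi Jn <> 0.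
Proof. by rewrite -piK0 => /piKP; rewrite subr0; apply: J_notin_Fplus_ker. Qed.

Definition lineJ (x : Q) : Prop := exists c : C, x = c *: pi Jn.

Lemma lineJ_submodule : submodule (@actK C n n n) lineJ.
Proof.
split; first split.
- by exists 0; rewrite scale0r.
- by move=> a u w [c ->] [c' ->]; exists (a * c + c'); rewrite scalerDl scalerA.
by move=> g w _ [c ->]; exists (c * \det g ^+ 2); rewrite actKZ actK_J scalerA.
Qed.

Lemma lineJ_irreducible : irreducible (@actK C n n n) lineJ.
Proof.
split; first exact: lineJ_submodule.
  by exists (pi Jn); [exists 1; rewrite scale1r | exact: piJ_neq0].
move=> W' sW' W'l [w W'w w0] _ [c ->].
have [b wb] := W'l w W'w.
have b0 : b != 0 by apply: contra_not_neq w0 => b0; rewrite wb b0 scale0r.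
have := sW'.1.2 (c / b) w 0 W'w sW'.1.1.
by rewrite addr0 wb scalerA divfK.
Qed.

Lemma lineJ_irrep : is_irrep (@actK C n n n) (nseq n 2%N) lineJ.
Proof.
split; first exact: lineJ_irreducible.
  exists 1%N, (fun=> pi Jn), (fun _ _ => gdet C n ^+ 2); split.
    split=> [_|x [c ->]]; first by exists 1; rewrite scale1r.
    exists (const_mx c); split=> [|c']; first by rewrite big_ord1 mxE.
    rewrite big_ord1 => /eqP; rewrite -subr_eq0 -scalerBl scaler_eq0 subr_eq0.
    case/orP=> [/eqP ->|/eqP /piJ_neq0 //].
    by apply/rowP => i; rewrite mxE (ord1 i).
  by move=> g _ _; rewrite actK_J big_ord1 rmorphXn /= meval_gdet.
exists (pi Jn); first by exists 1; rewrite scale1r.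
split; first exact: piJ_neq0.
  move=> D _; rewrite actK_J det_diag -prodrXl; congr (_ *: _).
  by apply: eq_bigr => i _; rewrite nth_nseq ltn_ord.
by move=> g ug; rewrite actK_J det_unitriangular // expr1n scale1r.
Qed.

(** The highest weight vector of [W] is semi-invariant, hence lies on the line of [J]. So [W] meets
    that line in a nonzero submodule, which is all of [W] by irreducibility. *)
Lemma irrep_lineJ (W : Q -> Prop) : is_irrep (@actK C n n n) (nseq n 2%N) W ->
  (forall x, W x -> @kerK C n n n x) -> forall x, W x -> lineJ x.
Proof.
case=> irrW polW [w Ww hw] Wk.
have [subW _ minW] := irrW.
have [f kf wf] := Wk w Ww.
have semiw g : g \in unitmx -> actK g w = \det g ^+ 2 *: w.
  exact: (highest_weight_semi (@actKP C n n n) (@actKM C n n n) (@actK1 C n n n) subW polW Ww hw).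
have [c wc] : lineJ w.
  have [g ug|c fc] := @semi_invariant_J C n hn f kf.
    by apply/piKP; rewrite -actK_pi piKZ -wf semiw.
  by exists c; rewrite wf -piKZ; apply/piKP.
have [w0 _ _] := hw.
move=> x Wx; apply: (minW (fun y => W y /\ lineJ y) _ _ _ x Wx).2.
- have [[W0 WP] Wact] := subW; have [[l0 lP] lact] := lineJ_submodule; split; first split.
  + by [].
  + by move=> a u y [Wu lu] [Wy ly]; split; [apply: WP | apply: lP].
  by move=> g y ug [Wy ly]; split; [apply: Wact | apply: lact].
- by move=> y [].
by exists w => //; split=> //; exists c.
Qed.

Lemma mult_nn : mult_nm C n n (nseq n 2%N) 1.
Proof.
exists (fun=> lineJ); split.
- move=> _; split; first exact: lineJ_irrep.
  move=> _ [c ->]; exists (c *: Jn); last by rewrite piKZ.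
  by rewrite /ker_phi /phi comp_mpolyZ; move: (J_ker C hn (leqnn n)); rewrite /phi => ->; rewrite scaler0.
- by move=> w _; rewrite big_ord1 => w0 a; rewrite ord1.
move=> W' irrW' W'k x W'x; exists (fun=> x); last by rewrite big_ord1.
by move=> _; apply: irrep_lineJ W'x.
Qed.

End Multiplicity.

Theorem theorem3p2 (R : realType) (n m : nat) (hn : (2 <= n)%N) (hnm : (n <= m)%N) :
  (ker_phi n (J R[i] hnm) /\ ~ Fplus_ker n (J R[i] hnm))
  /\ mult R[i] n (nseq n 2%N) 1.
Proof.
split; first by split; [apply: J_ker | apply: J_notin_Fplus_ker].
rewrite /mult (_ : height _ = n); first exact: mult_nn.
by rewrite /height count_nseq mul1n.
Qed.
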